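(* Let $p$ be a prime of the form $8k+1$ and $a\in\mathbb Z$ with $2\nmid a$. Suppose that $p=c^2+d^2=x^2+(a^2+1)y^2$ with $c,d,x,y\in\mathbb Z$, $c\equiv 1\pmod 4$, $d=2^rd_0$, $d_0\equiv 1\pmod 4$ and $4\mid y$. Assume $(c,x+d)=1$ or $(d_0,x+c)=1$. Then $$\left(a+\sqrt{a^2+1}\right)^{\frac{p-1}4}\equiv(-1)^{\frac d4+\frac y4}\pmod p.$$
   Context: $(m,n)$ is the greatest common divisor; $r$ is a nonnegative integer. The congruence is understood in the ring $\mathbb Z[\sqrt{a^2+1}]$ modulo the ideal generated by $p$. *)

(* Defs.v *)
From mathcomp Require Import all_boot all_order all_algebra all_field.

Set Implicit Arguments.
Unset Strict Implicit.
Unset Printing Implicit Defensive.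

Import GRing.Theory Num.Theory.
Local Open Scope ring_scope.

(* The ring Z[sqrt D], as a subset of the algebraic complex numbers. For D >= 0,
   [sqrtC D] is the nonnegative real square root. *)
Definition Zsqrt (D : int) (z : algC) : Prop :=
  exists u v : int, z = u%:~R + v%:~R * sqrtC D%:~R.

(* Congruence in Z[sqrt D] modulo the principal ideal generated by m. *)
Definition Zsqrt_eqmod (D m : int) (z w : algC) : Prop :=
  [/\ Zsqrt D z, Zsqrt D w & exists2 t, Zsqrt D t & z - w = m%:~R * t].

(* Main.v *)
Require Import Defs.
From HB Require Import structures.
From mathcomp Require Import all_boot all_order all_algebra all_field.
From mathcomp Require Import cyclic zify ring.
Set Implicit Arguments.
Unset Strict Implicit.
Unset Printing Implicit Defensive.
Import Order.TTheory GRing.Theory Num.Theory.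
Local Open Scope ring_scope.

(** Write [pi = c + d i], a Gaussian prime of norm [p], and [rho = x - a y i]. Modulo
[pi] the equation [x ^ 2 + (a ^ 2 + 1) y ^ 2 = p] makes [x i / y] a square root of
[a ^ 2 + 1], so that [a + sqrt (a ^ 2 + 1)] becomes [i rho / y], and the theorem
computes a quartic residue symbol:
   [(i rho / pi) = (y / pi) (-1) ^ ((d + y) / 4)].
The other square root gives the same sign because the two values [a + S] and [a - S]
have product [-1].

The computation rests on the relation [N(rho) = p - y ^ 2], hence [pi (conj pi) = y ^ 2]
modulo [rho]. Signs can be chosen so that [x = 1] modulo 4, [d > 0] and [y > 0].
Put [g = gcd (c, d + y)], up to sign, [kappa = (pi + i y) / g = c' + e i] and
[M' = N(rho) / g = g N(kappa) - 2 y e]. Then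
   [kappa y - i pi (conj kappa) = - i M'].
For a prime [nu] dividing both [rho] and [M'] this gives
[(i pi / nu) = (y / nu) (kappa / nu) (kappa / conj nu)]; for the other primes dividing
[rho], [nu] divides [g], so [i pi = y] modulo [nu]. Multiplying over the
primes of [rho], and using [(rho / pi) = (pi / rho)], one gets the symbol of [kappa]
modulo a rational integer [M1 = M' g2], where every prime divisor of [g2] divides [e].
By reciprocity it is the symbol of [M1] modulo [kappa]. There [M' = - 2 y e], while
[g2] and the odd part of [e] contribute nothing, since [kappa] is rational modulo
their prime divisors. The odd part of [y] has the same symbol modulo [kappa] as modulo [pi], since
[g kappa = pi] modulo [y], and a trivial one modulo [rho]. Only powers of 2 remain, and the symbol of
2 modulo [u + v i], with [u = 1] and [v = 0] modulo 4, is [(-1) ^ (v / 4)]. This is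
[key_symbol].

Quartic reciprocity for primary Gaussian integers is proved through the quartic Gauss
sum [G] of a prime [nu] of norm [p = 1] modulo 4. The Jacobi sum of the quartic and the
quadratic characters has norm [p], is divisible by [nu] and is congruent to [-1] modulo
[2 + 2 i], so it equals [- nu]; whence [G ^ 4 = nu ^ 3 (conj nu)]. For an odd prime [l],
the value of [G ^ l] modulo [l], in the ring of algebraic integers, compares the symbol of
[l] modulo [nu] with that of [nu] modulo [l]. The case of two nonreal primes [nu] and [th]
follows from that of rational integers: the real part [n] of [nu (conj th)] is
[Re (nu) th] modulo [nu] and [Re (th) nu] modulo [th], and modulo [n] the product
[nu (conj th)] is [i] times a rational integer. Composite moduli are lists of primary
primes, over which symbols are multiplied ([quartic_reciprocity]). *)

(** * The ring of Gaussian integers *)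

Record gint := GInt { gre : int; gim : int }.

Definition pair_of_gint (a : gint) := (gre a, gim a).
Definition gint_of_pair (a : int * int) := GInt a.1 a.2.
Lemma pair_of_gintK : cancel pair_of_gint gint_of_pair.
Proof. by case. Qed.

HB.instance Definition _ := Equality.copy gint (can_type pair_of_gintK).
HB.instance Definition _ := Choice.copy gint (can_type pair_of_gintK).

Lemma gint_eq (a b : gint) : gre a = gre b -> gim a = gim b -> a = b.
Proof. by case: a b => [a1 a2] [b1 b2] /= -> ->. Qed.

Definition gadd (a b : gint) := GInt (gre a + gre b) (gim a + gim b).
Definition gopp (a : gint) := GInt (- gre a) (- gim a).
Definition gmul (a b : gint) :=
  GInt (gre a * gre b - gim a * gim b) (gre a * gim b + gim a * gre b).

Fact gaddA : associative gadd.
Proof. by move=> a b c; apply: gint_eq => /=; ring. Qed.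
Fact gaddC : commutative gadd.
Proof. by move=> a b; apply: gint_eq => /=; ring. Qed.
Fact gadd0 : left_id (GInt 0 0) gadd.
Proof. by move=> a; apply: gint_eq => /=; ring. Qed.
Fact gaddN : left_inverse (GInt 0 0) gopp gadd.
Proof. by move=> a; apply: gint_eq => /=; ring. Qed.
HB.instance Definition _ := GRing.isZmodule.Build gint gaddA gaddC gadd0 gaddN.

Fact gmulA : associative gmul.
Proof. by move=> a b c; apply: gint_eq => /=; ring. Qed.
Fact gmulC : commutative gmul.
Proof. by move=> a b; apply: gint_eq => /=; ring. Qed.
Fact gmul1 : left_id (GInt 1 0) gmul.
Proof. by move=> a; apply: gint_eq => /=; ring. Qed.
Fact gmulDl : left_distributive gmul gadd.
Proof. by move=> a b c; apply: gint_eq => /=; ring. Qed.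
Fact gint1_neq0 : GInt 1 0 != 0.
Proof. by []. Qed.
HB.instance Definition _ :=
  GRing.Zmodule_isComNzRing.Build gint gmulA gmulC gmul1 gmulDl gint1_neq0.

Lemma greD (a b : gint) : gre (a + b) = gre a + gre b. Proof. by []. Qed.
Lemma gimD (a b : gint) : gim (a + b) = gim a + gim b. Proof. by []. Qed.
Lemma greN (a : gint) : gre (- a) = - gre a. Proof. by []. Qed.
Lemma gimN (a : gint) : gim (- a) = - gim a. Proof. by []. Qed.
Lemma greM (a b : gint) : gre (a * b) = gre a * gre b - gim a * gim b. Proof. by []. Qed.
Lemma gimM (a b : gint) : gim (a * b) = gre a * gim b + gim a * gre b. Proof. by []. Qed.

Lemma intr_gint (n : int) : n%:~R = GInt n 0.
Proof.
have nat_gint (m : nat) : m%:R = GInt m 0.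
  by elim: m => // m IH; rewrite mulrS IH; apply: gint_eq => /=; lia.
by case: n => m; rewrite ?NegzE ?mulrNz -pmulrn nat_gint //.
Qed.
Lemma gre_int (n : int) : gre n%:~R = n. Proof. by rewrite intr_gint. Qed.
Lemma gim_int (n : int) : gim n%:~R = 0. Proof. by rewrite intr_gint. Qed.
Lemma gre1 : gre 1 = 1. Proof. by []. Qed.
Lemma gim1 : gim 1 = 0. Proof. by []. Qed.

Definition gI := GInt 0 1.
Definition gE := (greD, gimD, greN, gimN, greM, gimM, gre_int, gim_int, gre1, gim1).

Lemma gintE (a : gint) : a = (gre a)%:~R + (gim a)%:~R * gI.
Proof. by apply: gint_eq; rewrite !gE /=; ring. Qed.

Lemma gI2 : gI * gI = -1.
Proof. by []. Qed.


Definition gconj (a : gint) := GInt (gre a) (- gim a).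

Fact gconj_is_additive : zmod_morphism gconj.
Proof. by move=> a b; apply: gint_eq; rewrite /= ?gE /=; ring. Qed.
HB.instance Definition _ := GRing.isZmodMorphism.Build gint gint gconj gconj_is_additive.
Fact gconj_is_multiplicative : monoid_morphism gconj.
Proof. by split=> // a b; apply: gint_eq; rewrite /= ?gE /=; ring. Qed.
HB.instance Definition _ :=
  GRing.isMonoidMorphism.Build gint gint gconj gconj_is_multiplicative.

Lemma gconjK : involutive gconj.
Proof. by move=> a; apply: gint_eq => //=; rewrite opprK. Qed.
Lemma gconj_int (n : int) : gconj n%:~R = n%:~R.
Proof. exact: rmorph_int. Qed.

Definition gnorm (a : gint) : int := gre a ^+ 2 + gim a ^+ 2.

Lemma gnormE (a : gint) : (gnorm a)%:~R = a * gconj a.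
Proof. by apply: gint_eq; rewrite !gE /= /gnorm; ring. Qed.
Lemma gnormM (a b : gint) : gnorm (a * b) = gnorm a * gnorm b.
Proof. by rewrite /gnorm !gE; ring. Qed.
Lemma gnorm_conj (a : gint) : gnorm (gconj a) = gnorm a.
Proof. by rewrite /gnorm /= sqrrN. Qed.
Lemma gnorm_int (n : int) : gnorm n%:~R = n ^+ 2.
Proof. by rewrite /gnorm !gE; ring. Qed.
Lemma gnorm_ge0 (a : gint) : 0 <= gnorm a.
Proof. by rewrite addr_ge0 ?sqr_ge0. Qed.
Lemma gnorm_eq0 (a : gint) : (gnorm a == 0) = (a == 0).
Proof.
rewrite paddr_eq0 ?sqr_ge0 // !sqrf_eq0; apply/andP/eqP => [[/eqP h1 /eqP h2]|-> //].
exact: gint_eq.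
Qed.

Lemma gmulI (c a b : gint) : c != 0 -> c * a = c * b -> a = b.
Proof.
rewrite -gnorm_eq0 => nz eq_ab.
have : (gnorm c)%:~R * a = (gnorm c)%:~R * b.
  by rewrite gnormE ![_ * gconj c]mulrC -!mulrA eq_ab.
move/[dup]/(congr1 gre) => + /(congr1 gim).
rewrite !gE !mul0r !subr0 => hr hi.
apply: gint_eq; apply: (mulfI nz) => //.
Qed.

(** Multiplication by the conjugate of the divisor turns divisibility into that of two
integers by a norm, which is decidable. *)
Definition dvdg (a b : gint) : bool :=
  (gnorm a %| gre (gconj a * b))%Z && (gnorm a %| gim (gconj a * b))%Z.

Lemma dvdgP (a b : gint) : a != 0 -> reflect (exists c, b = a * c) (dvdg a b).
Proof.
move=> nz; apply: (iffP andP) => [[/dvdzP[u hu] /dvdzP[v hv]]|[c ->]].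
  exists (GInt u v); apply: (@gmulI (gconj a)); first by rewrite -gnorm_eq0 gnorm_conj gnorm_eq0.
  rewrite mulrA [gconj a * a]mulrC -gnormE.
  by apply: gint_eq; rewrite ?hu ?hv !gE /=; ring.
rewrite mulrA [gconj a * a]mulrC -gnormE !gE !mul0r subr0 addr0.
by split; apply: dvdz_mulr.
Qed.

Lemma dvdg_int (n : int) a : n != 0 -> dvdg n%:~R a = (n %| gre a)%Z && (n %| gim a)%Z.
Proof.
move=> nz; rewrite /dvdg gconj_int gnorm_int !gE !mul0r subr0 addr0 expr2.
by rewrite !dvdz_mul2l ?nz.
Qed.

Lemma dvdg_intint (m n : int) : m != 0 -> dvdg m%:~R n%:~R = (m %| n)%Z.
Proof. by move=> nz; rewrite dvdg_int // !gE dvdz0 andbT. Qed.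

Section Dvdg.
Variable c : gint.
Hypothesis c_nz : c != 0.

Lemma dvdg_refl : dvdg c c.
Proof. by apply/dvdgP => //; exists 1; rewrite mulr1. Qed.
Lemma dvdg0 : dvdg c 0.
Proof. by apply/dvdgP => //; exists 0; rewrite mulr0. Qed.
Lemma dvdgD (a b : gint) : dvdg c a -> dvdg c b -> dvdg c (a + b).
Proof.
move=> /dvdgP-/(_ c_nz)[u ->] /dvdgP-/(_ c_nz)[v ->].
by apply/dvdgP => //; exists (u + v); rewrite mulrDr.
Qed.
Lemma dvdgMr (a b : gint) : dvdg c a -> dvdg c (a * b).
Proof. by move=> /dvdgP-/(_ c_nz)[u ->]; apply/dvdgP => //; exists (u * b); rewrite mulrA. Qed.
Lemma dvdgMl (a b : gint) : dvdg c b -> dvdg c (a * b).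
Proof. by rewrite mulrC; apply: dvdgMr. Qed.
Lemma dvdgN (a : gint) : dvdg c (- a) = dvdg c a.
Proof. by apply/idP/idP => /(dvdgMl (-1)); rewrite ?mulN1r ?opprK. Qed.
Lemma dvdgB (a b : gint) : dvdg c a -> dvdg c b -> dvdg c (a - b).
Proof. by move=> ha hb; apply: dvdgD => //; rewrite dvdgN. Qed.
Lemma dvdg_sym (a b : gint) : dvdg c (a - b) = dvdg c (b - a).
Proof. by rewrite -dvdgN opprB. Qed.
Lemma dvdg_trans_mod (b a d : gint) : dvdg c (a - b) -> dvdg c (b - d) -> dvdg c (a - d).
Proof.
move=> h1 h2; have -> : a - d = (a - b) + (b - d) by ring.
by rewrite dvdgD.
Qed.
Lemma dvdg_addr (a b : gint) : dvdg c (a - b) -> dvdg c a = dvdg c b.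
Proof.
move=> h; apply/idP/idP => h'.
  have -> : b = a - (a - b) by ring.
  by rewrite dvdgB.
have -> : a = (a - b) + b by ring.
by rewrite dvdgD.
Qed.
Lemma dvdg_modM (a b a' b' : gint) : dvdg c (a - a') -> dvdg c (b - b') -> dvdg c (a * b - a' * b').
Proof.
move=> h1 h2; have -> : a * b - a' * b' = (a - a') * b + a' * (b - b') by ring.
exact: dvdgD (dvdgMr _ h1) (dvdgMl _ h2).
Qed.
Lemma dvdg_modX (a b : gint) n : dvdg c (a - b) -> dvdg c (a ^+ n - b ^+ n).
Proof. by move=> h; elim: n => [|n IH]; rewrite ?subrr ?dvdg0 // !exprS dvdg_modM. Qed.
Lemma dvdg_modD (a b a' b' : gint) : dvdg c (a - a') -> dvdg c (b - b') -> dvdg c (a + b - (a' + b')).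
Proof.
move=> h1 h2; have -> : a + b - (a' + b') = (a - a') + (b - b') by ring.
by rewrite dvdgD.
Qed.
Lemma dvdg_norm (a : gint) : dvdg c a -> (gnorm c %| gnorm a)%Z.
Proof. by move=> /dvdgP-/(_ c_nz)[u ->]; rewrite gnormM dvdz_mulr. Qed.
Lemma dvdg_conj (a : gint) : dvdg (gconj c) (gconj a) = dvdg c a.
Proof.
have nz' : gconj c != 0 by rewrite -gnorm_eq0 gnorm_conj gnorm_eq0.
apply/(dvdgP _ nz')/(dvdgP _ c_nz) => -[u hu]; exists (gconj u).
  by rewrite -[a]gconjK hu rmorphM /= gconjK.
by rewrite hu rmorphM.
Qed.
Lemma dvdg_normr : dvdg c (gnorm c)%:~R.
Proof. by rewrite gnormE dvdgMr ?dvdg_refl. Qed.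
Lemma dvdg_dvdz (m n : int) : dvdg c m%:~R -> (m %| n)%Z -> dvdg c n%:~R.
Proof. by move=> h /dvdzP[d ->]; rewrite rmorphM dvdgMl. Qed.
End Dvdg.

(** * Primary Gaussian primes and their residue fields *)

Lemma Euclid_dvdzM p m n : prime p -> (p%:Z %| m * n)%Z = (p%:Z %| m)%Z || (p%:Z %| n)%Z.
Proof. by move=> pr; rewrite !dvdzE abszM Euclid_dvdM. Qed.

Lemma Euclid_dvdzX p m k : prime p -> (p%:Z %| m ^+ k)%Z -> (p%:Z %| m)%Z.
Proof. by move=> pr; rewrite !dvdzE abszX Euclid_dvdX // => /andP[]. Qed.

Lemma prime_dvdz_gt1 p : prime p -> (p%:Z %| 1)%Z = false.
Proof. by move=> pr; rewrite dvdzE Euclid_dvd1. Qed.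

Lemma PoszX (m k : nat) : m%:Z ^+ k = (m ^ k)%N%:Z.
Proof. by rewrite -[m%:Z]natz -natrX natz. Qed.

(** The quotient of [(x + y) ^ l - x ^ l - y ^ l] by [l]; being explicit, it is seen to
belong to every subring containing [x] and [y]. *)
Definition frob_defect (R : comNzRingType) (l : nat) (x y : R) : R :=
  \sum_(i < l.-1) ('C(l, i.+1) %/ l)%:R * (x ^+ (l - i.+1) * y ^+ i.+1).

Lemma exprD_prime (R : comNzRingType) l (x y : R) : prime l ->
  (x + y) ^+ l = x ^+ l + y ^+ l + l%:R * frob_defect l x y.
Proof.
case: l => [|[|n]] // pr.
rewrite exprDn big_ord_recl big_ord_recr /= /bump /= !add1n.
rewrite subn0 bin0 subnn binn !expr0 mulr1 mul1r !mulr1n.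
rewrite addrA addrAC; congr (_ + _).
rewrite /frob_defect mulr_sumr; apply: eq_bigr => i _.
rewrite /bump /= add1n mulrA -natrM mulnC divnK ?mulr_natl //.
by apply: prime_dvd_bin => //; have := ltn_ord i; lia.
Qed.

(** This is congruence to 1 modulo [2 + 2 i]; a Gaussian integer of odd norm has exactly one
associate with this property. *)
Definition primary (a : gint) : bool := (2 %| gim a)%Z && (4 %| gre a + gim a - 1)%Z.

Lemma primaryM (a b : gint) : primary a -> primary b -> primary (a * b).
Proof.
case: a b => [a b] [c d]; rewrite /primary /= => /andP[/dvdzP[e ->] /dvdzP[f hf]].
move=> /andP[/dvdzP[g ->] /dvdzP[h hh]].
have -> : a = 4 * f + 1 - 2 * e by lia.
have -> : c = 4 * h + 1 - 2 * g by lia.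
apply/andP; split; apply/dvdzP.
  exists ((4 * f + 1 - 2 * e) * g + e * (4 * h + 1 - 2 * g)); ring.
exists (4 * f * h + f + h - 2 * e * g); ring.
Qed.

Lemma primary_conj (a : gint) : primary (gconj a) = primary a.
Proof. by case: a => a b; rewrite /primary /=; lia. Qed.


Lemma primary_norm (a : gint) : primary a -> (4 %| gnorm a - 1)%Z.
Proof.
case: a => a b; rewrite /primary /gnorm /= => /andP[/dvdzP[e ->] /dvdzP[f hf]].
have -> : a = 4 * f + 1 - 2 * e by lia.
by apply/dvdzP; exists (4 * f ^+ 2 + 2 * e ^+ 2 + 2 * f - e - 4 * f * e); ring.
Qed.

Definition split_prime (nu : gint) : bool := prime `|gnorm nu|%N.
Definition inert_prime (nu : gint) : Prop :=
  exists2 l : nat, prime l & (l %% 4 = 3)%N /\ nu = (- l%:Z)%:~R.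
Definition gprime (nu : gint) : Prop := primary nu /\ (split_prime nu \/ inert_prime nu).

Lemma absz_gnorm (a : gint) : (`|gnorm a|%N : int) = gnorm a.
Proof. exact: gez0_abs (gnorm_ge0 a). Qed.

Lemma gprime_norm_gt1 (nu : gint) : gprime nu -> 1 < gnorm nu.
Proof.
case=> _ [h|[l pr [_ ->]]]; first by have := prime_gt1 h; have := absz_gnorm nu; lia.
by rewrite gnorm_int; have := prime_gt1 pr; nia.
Qed.

Lemma gprime_nz (nu : gint) : gprime nu -> nu != 0.
Proof. by move=> /gprime_norm_gt1; rewrite -gnorm_eq0; lia. Qed.

Definition qexp (nu : gint) : nat := `|gnorm nu|%N.-1 %/ 4.

Lemma gprime_qexp (nu : gint) : gprime nu -> (`|gnorm nu| = (4 * qexp nu).+1 /\ 0 < qexp nu)%N.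
Proof.
move=> gp; have := gprime_norm_gt1 gp; have [/primary_norm] := gp.
by rewrite /qexp; have := absz_gnorm nu; lia.
Qed.

Lemma gprime_conj (nu : gint) : gprime nu -> gprime (gconj nu).
Proof.
case=> pn h; split; first by rewrite primary_conj.
case: h => [h|[l pr [l3 ->]]]; first by left; rewrite /split_prime gnorm_conj.
by right; exists l => //; split=> //; rewrite gconj_int.
Qed.

(** The imaginary part of [nu] is invertible modulo its norm, so [i] is congruent to a
rational integer. *)
Lemma split_residue (nu a : gint) : gprime nu -> split_prime nu ->
  exists r : nat, dvdg nu (a - r%:R).
Proof.
move=> gp sp; have nz := gprime_nz gp; have pr : prime `|gnorm nu|%N := sp.
set p := `|gnorm nu|%N in pr.
have pE : p%:Z = gnorm nu by rewrite absz_gnorm.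
have dp : dvdg nu p%:Z%:~R by rewrite pE dvdg_normr.
have cop : coprimez (gim nu) p%:Z.
  rewrite coprimezE coprime_sym prime_coprime //; apply/negP => div_im.
  have h1 : (p%:Z %| gim nu)%Z by rewrite dvdzE.
  have h2 : (p%:Z %| gre nu)%Z.
    apply: (@Euclid_dvdzX p _ 2 pr).
    have -> : gre nu ^+ 2 = p%:Z - gim nu ^+ 2 by rewrite pE /gnorm; ring.
    by rewrite rpredB ?dvdzz // dvdz_exp.
  have : (p%:Z * p%:Z %| gnorm nu)%Z.
    by rewrite /gnorm !expr2 rpredD // dvdz_mul.
  by rewrite -pE dvdzE /= => /dvdn_leq -/(_ (prime_gt0 pr)); have := prime_gt1 pr; nia.
have [[u v] /= uv] := coprimezP _ _ cop.
have hI : dvdg nu (gI - (- gre nu * u)%:~R).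
  have -> : gI - (- gre nu * u)%:~R = u%:~R * nu + p%:Z%:~R * (v%:~R * gI).
    apply: gint_eq; rewrite !gE /=; first by ring.
    by rewrite subr0 -{1}uv; ring.
  exact: (dvdgD nz (dvdgMl nz _ (dvdg_refl nz)) (dvdgMr nz _ dp)).
pose m := gre a + gim a * (- gre nu * u).
have hm : dvdg nu (a - m%:~R).
  have -> : a - m%:~R = (gim a)%:~R * (gI - (- gre nu * u)%:~R).
    by apply: gint_eq; rewrite /m !gE /=; ring.
  by rewrite dvdgMl.
exists `|(m %% p)%Z|%N.
apply: (dvdg_trans_mod nz hm).
have p0 : p%:Z != 0 by have := prime_gt0 pr; lia.
rewrite -[_%:R]/((`|(m %% p)%Z|%N)%:Z%:~R) gez0_abs ?modz_ge0 // -rmorphB /=.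
apply: (dvdg_dvdz nz dp).
by rewrite {1}(divz_eq m p) addrK dvdz_mull.
Qed.

Lemma split_dvdg_int (nu : gint) (n : int) : gprime nu -> split_prime nu ->
  dvdg nu n%:~R = (gnorm nu %| n)%Z.
Proof.
move=> gp sp; have nz := gprime_nz gp; apply/idP/idP => [/(dvdg_norm nz)|].
  by rewrite gnorm_int -(absz_gnorm nu); apply: Euclid_dvdzX.
exact: dvdg_dvdz (dvdg_normr nz).
Qed.

Lemma nat_Fermat p (m : nat) : prime p -> ~~ (p %| m)%N -> exists q : nat, (m ^ p.-1 = p * q + 1)%N.
Proof.
move=> pr ndv; exists (m ^ p.-1 %/ p)%N.
have := Euler_exp_totient (a := m) (n := p); rewrite totient_prime // coprime_sym prime_coprime // ndv.
move=> /(_ isT) h; rewrite {1}(divn_eq (m ^ p.-1) p) h mulnC modn_small //.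
exact: prime_gt1.
Qed.


(** Otherwise, raising [u ^ 2 = - v ^ 2] to the odd power [(l - 1) / 2] would give [1 = -1]
modulo [l]. *)
Lemma sum_sqr_dvd3 (l : nat) (u v : int) : prime l -> (l %% 4 = 3)%N ->
  (l%:Z %| u ^+ 2 + v ^+ 2)%Z -> (l%:Z %| u)%Z.
Proof.
move=> pr l3 dv; apply/negPn/negP => ndu.
have ndv : ~~ (l%:Z %| v)%Z.
  apply/negP => h; move/negP: ndu; apply; apply: (@Euclid_dvdzX l u 2 pr).
  have -> : u ^+ 2 = (u ^+ 2 + v ^+ 2) - v ^+ 2 by ring.
  by rewrite rpredB // dvdz_exp.
have l2 : (2 * (l %/ 2))%N = l.-1 by move: l3; clear; lia.
have fer (w : int) : ~~ (l%:Z %| w)%Z -> (l%:Z %| (w ^+ 2) ^+ (l %/ 2) - 1)%Z.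
  rewrite dvdzE => /(nat_Fermat pr)[q hq].
  have -> : w ^+ 2 = (`|w|%N ^ 2)%N%:Z by rewrite -abszX gez0_abs ?sqr_ge0.
  rewrite (PoszX (`|w| ^ 2) (l %/ 2)).
  rewrite -(expnM `|w| 2 (l %/ 2)) l2.
  by apply/dvdzP; exists q%:Z; rewrite hq PoszD PoszM addrK mulrC.
have hodd : ((-1) ^+ (l %/ 2) = -1 :> int).
  by rewrite -signr_odd (_ : odd _ = true) //; move: l3; clear; lia.
have hs : (l%:Z %| (u ^+ 2) ^+ (l %/ 2) + (v ^+ 2) ^+ (l %/ 2))%Z.
  have -> : (u ^+ 2) ^+ (l %/ 2) + (v ^+ 2) ^+ (l %/ 2)
            = (u ^+ 2) ^+ (l %/ 2) - (- v ^+ 2) ^+ (l %/ 2).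
    by rewrite [(- _) ^+ _]exprNn hodd; ring.
  by rewrite subrXX dvdz_mulr // opprK.
have := rpredB (rpredB hs (fer u ndu)) (fer v ndv).
rewrite (_ : _ - _ = 2); last by ring.
by rewrite dvdzE /= => /dvdn_leq; move: l3; clear; lia.
Qed.

Lemma dvdg_natN (l : nat) a : (0 < l)%N ->
  dvdg (- l%:Z)%:~R a = (l%:Z %| gre a)%Z && (l%:Z %| gim a)%Z.
Proof. by move=> l0; rewrite dvdg_int ?dvdzE ?abszN //; lia. Qed.

(** If [nu] is inert, a prime [l = 3] modulo 4 that divides a norm divides the element; if
[nu] splits, both factors have rational residues. *)
Lemma gprime_Euclid (nu a b : gint) : gprime nu -> dvdg nu (a * b) -> dvdg nu a || dvdg nu b.
Proof.
move=> gp; have nz := gprime_nz gp.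
have [_ [sp|[l pr [l3 nuE]]]] := gp; last first.
  have hd x : dvdg nu x = (l%:Z %| gre x)%Z && (l%:Z %| gim x)%Z.
    by rewrite nuE dvdg_natN ?prime_gt0.
  have key x : (l%:Z %| gnorm x)%Z -> dvdg nu x.
    move=> h; rewrite hd (sum_sqr_dvd3 pr l3 h) (@sum_sqr_dvd3 l _ (gre x)) //.
    by rewrite addrC.
  move=> /(dvdg_norm nz) h.
  have : (l%:Z %| gnorm a * gnorm b)%Z.
    move: h; rewrite nuE gnormM gnorm_int sqrrN; apply: dvdz_trans.
    by rewrite dvdz_exp // dvdzz.
  by rewrite Euclid_dvdzM // => /orP[] /key ->; rewrite ?orbT.
have [m hm] := split_residue a gp sp; have [n hn] := split_residue b gp sp.
rewrite (dvdg_addr nz (dvdg_modM nz hm hn)) (dvdg_addr nz hm) (dvdg_addr nz hn).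
have hd (k : nat) : dvdg nu k%:R = (`|gnorm nu|%N %| k)%N.
  by rewrite -[k%:R]/(k%:Z%:~R) split_dvdg_int // dvdzE.
by rewrite -natrM !hd Euclid_dvdM.
Qed.

Lemma gprime_EuclidE (nu a b : gint) : gprime nu -> dvdg nu (a * b) = dvdg nu a || dvdg nu b.
Proof.
move=> gp; have nz := gprime_nz gp; apply/idP/orP; first by move/(gprime_Euclid gp)/orP.
by case=> h; [apply: dvdgMr | apply: dvdgMl].
Qed.


Lemma nat_Fermat_dvdg nu p (m : nat) : nu != 0 -> prime p -> dvdg nu p%:R -> ~~ (p %| m)%N ->
  dvdg nu (m%:R ^+ p.-1 - 1).
Proof.
move=> nz pr dp /(nat_Fermat pr)[q hq].
by rewrite -natrX hq natrD natrM addrK dvdgMr.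
Qed.

(** The [l]-th power fixes rational integers modulo [l], and [i ^ l = - i]. *)
Lemma inert_Frobenius (l : nat) a : prime l -> (l %% 4 = 3)%N ->
  dvdg l%:R (a ^+ l - gconj a).
Proof.
move=> pr l3.
have nz : (l%:R : gint) != 0.
  by rewrite -gnorm_eq0 -[l%:R]/(l%:Z%:~R) gnorm_int; have := prime_gt0 pr; nia.
have fer (w : int) : dvdg l%:R (w%:~R ^+ l - w%:~R).
  rewrite -rmorphXn -rmorphB /= -[l%:R]/(l%:Z%:~R) dvdg_intint; last by have := prime_gt0 pr; lia.
  have l0 : l%:Z != 0 by have := prime_gt0 pr; lia.
  rewrite -eqz_mod_dvd -modzXm -[X in _ == X]modz_mod.
  rewrite -(gez0_abs (modz_ge0 w l0)) PoszX !modz_nat eqz_nat.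
  by apply/eqP; rewrite fermat_little // modn_mod.
rewrite {1}(gintE a) exprD_prime //.
have -> : ((gim a)%:~R * gI) ^+ l = (gim a)%:~R ^+ l * - gI.
  rewrite exprMn; congr (_ * _).
  by rewrite (divn_eq l 4) l3 exprD mulnC exprM (_ : gI ^+ 4 = 1) // expr1n mul1r.
have -> : gconj a = (gre a)%:~R + (gim a)%:~R * - gI.
  by apply: gint_eq; rewrite /= !gE /=; ring.
rewrite addrAC; apply: (dvdgD nz); last by rewrite dvdgMr ?dvdg_refl.
apply: (dvdg_modD nz) => //; apply: (dvdg_modM nz) => //.
by rewrite subrr dvdg0.
Qed.

(** In the inert case, [a ^ (l + 1)] is congruent to the rational integer [N(a)]. *)
Lemma gprime_Fermat (nu a : gint) : gprime nu -> ~~ dvdg nu a -> dvdg nu (a ^+ (4 * qexp nu) - 1).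
Proof.
move=> gp nda; have nz := gprime_nz gp.
have [qE _] := gprime_qexp gp.
have [_ [sp|[l pr [l3 nuE]]]] := gp.
  have [m hm] := split_residue a gp sp.
  have dp : dvdg nu (`|gnorm nu|%N)%:R by rewrite -[_%:R]/(_%:Z%:~R) absz_gnorm dvdg_normr.
  apply: (dvdg_trans_mod nz (dvdg_modX nz _ hm)).
  have -> : (4 * qexp nu)%N = `|gnorm nu|%N.-1 by lia.
  apply: nat_Fermat_dvdg => //; apply/negP => h; move/negP: nda; apply.
  rewrite (dvdg_addr nz hm).
  by apply: (dvdg_dvdz nz (m := `|gnorm nu|%N) (n := m) dp); rewrite dvdzE.
have hd x y : dvdg nu (x - y) = dvdg l%:R (x - y).
  have l0 := prime_gt0 pr.
  by rewrite nuE dvdg_natN // -[l%:R]/(l%:Z%:~R) dvdg_int //; lia.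
have -> : (4 * qexp nu = l.+1 * l.-1)%N.
  have : (l ^ 2 = (4 * qexp nu).+1)%N by rewrite -qE nuE gnorm_int sqrrN abszX.
  by have := prime_gt1 pr; move: (qexp nu) => k; clear; nia.
have hN : dvdg nu (a ^+ l.+1 - (gnorm a)%:~R).
  rewrite gnormE exprS; apply: (dvdg_modM nz); first by rewrite subrr dvdg0.
  by rewrite hd inert_Frobenius.
rewrite exprM; apply: (dvdg_trans_mod nz (dvdg_modX nz _ hN)).
rewrite -(absz_gnorm a); apply: (@nat_Fermat_dvdg nu l) => //.
  by rewrite nuE dvdg_natN ?prime_gt0 // -[l%:R]/(l%:Z%:~R) !gE dvdzz dvdz0.
apply/negP => dl; move/negP: nda; apply.
have dl' : (l%:Z %| gre a ^+ 2 + gim a ^+ 2)%Z by rewrite -[_ + _]/(gnorm a) dvdzE.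
rewrite nuE dvdg_natN ?prime_gt0 //.
by rewrite (sum_sqr_dvd3 pr l3 dl') (@sum_sqr_dvd3 l _ (gre a)) // addrC.
Qed.

(** * The quartic residue symbol *)

(** The power of [i] congruent to [a ^ ((N(nu) - 1) / 4)] modulo [nu], or 0 if [nu]
divides [a]. *)
Definition qsym (nu a : gint) : gint :=
  if [pick e : 'I_4 | dvdg nu (a ^+ qexp nu - gI ^+ e)] is Some e then gI ^+ e else 0.

Definition qunits : seq gint := [:: 1; gI; -1; - gI].
Definition qvals : seq gint := 0 :: qunits.

Lemma qunits_vals z : z \in qunits -> z \in qvals.
Proof. by move=> h; rewrite in_cons h orbT. Qed.

Lemma qunitsM z w : z \in qunits -> w \in qunits -> z * w \in qunits.
Proof. by rewrite !inE => /or4P[]/eqP-> /or4P[]/eqP->. Qed.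

Lemma qvalsM z w : z \in qvals -> w \in qvals -> z * w \in qvals.
Proof.
by rewrite !inE => /or4P[||| /orP[]] /eqP-> /or4P[||| /orP[]] /eqP->.
Qed.


Lemma qunits_mulC z : z \in qunits -> z * gconj z = 1.
Proof. by rewrite !inE => /or4P[]/eqP->. Qed.

Lemma qunits_conjX z : z \in qunits -> gconj z = z ^+ 3.
Proof. by rewrite !inE => /or4P[]/eqP->. Qed.

Lemma qunitsX4 z : z \in qunits -> z ^+ 4 = 1.
Proof. by rewrite !inE => /or4P[]/eqP->. Qed.

Lemma qunits_norm z : z \in qunits -> gnorm z = 1.
Proof. by rewrite !inE => /or4P[]/eqP->. Qed.


Lemma qunits_I n : gI ^+ n \in qunits.
Proof. by elim: n => // n IH; rewrite exprS qunitsM. Qed.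

Lemma gI4 n : gI ^+ (4 * n) = 1.
Proof. by rewrite exprM (_ : gI ^+ 4 = 1) // expr1n. Qed.


(** The difference of two of these values has norm 0, 1, 2 or 4, while [nu] has an odd norm greater
than 1. *)
Lemma qvals_inj nu z w : gprime nu -> z \in qvals -> w \in qvals ->
  dvdg nu (z - w) -> z = w.
Proof.
move=> gp hz hw h; apply/eqP/negPn/negP => zw.
have {}h := dvdg_norm (gprime_nz gp) h.
have nrm : gnorm (z - w) \in [:: 1; 2; 4].
  move: zw; move: hz hw {h}; rewrite !inE.
  by case/or4P => [||| /orP[]] /eqP-> /or4P[||| /orP[]] /eqP->.
have := gprime_norm_gt1 gp; have [qE q0] := gprime_qexp gp.
move: h; rewrite -(absz_gnorm nu) qE => /dvdzP[k hk].
move: nrm; rewrite hk !inE; move: (qexp nu) q0 k {hk qE} => q q0 k.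
by have [h1|h1] := lerP k 0; have h2 : (0 < q%:Z) by []; clear -h1 h2; case/or3P => /eqP; nia.
Qed.

Lemma qsym_val nu a : qsym nu a \in qvals.
Proof. by rewrite /qsym; case: pickP => [e _|_] //; rewrite qunits_vals ?qunits_I. Qed.

Section qsyms.
Variable nu : gint.
Hypothesis gp : gprime nu.
Let nz := gprime_nz gp.

Lemma gprimeX (a : gint) n : dvdg nu (a ^+ n) -> dvdg nu a.
Proof.
elim: n => [|n IH]; last by rewrite exprS => /(gprime_Euclid gp)/orP[].
rewrite expr0 => /(dvdg_norm nz); rewrite -(absz_gnorm nu) dvdzE /= dvdn1 => /eqP h.
by have := gprime_norm_gt1 gp; rewrite -(absz_gnorm nu) h.
Qed.

Lemma qsym_dvd (a : gint) : dvdg nu a -> qsym nu a = 0.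
Proof.
move=> da; rewrite /qsym; case: pickP => [e|//]; have [_ q0] := gprime_qexp gp.
have dX : dvdg nu (a ^+ qexp nu) by rewrite -(prednK q0) exprS dvdgMr.
rewrite dvdg_sym // => h; have : dvdg nu (gI ^+ e) by rewrite (dvdg_addr nz h).
move=> h'; have := @qvals_inj nu (gI ^+ e) 0 gp; rewrite subr0 h'.
by move=> -> //; rewrite qunits_vals ?qunits_I.
Qed.

Lemma qsym_spec (a : gint) : dvdg nu (a ^+ qexp nu - qsym nu a).
Proof.
have [da|nda] := boolP (dvdg nu a).
  rewrite qsym_dvd // subr0; have [_ q0] := gprime_qexp gp.
  by rewrite -(prednK q0) exprS dvdgMr.
rewrite /qsym; case: pickP => [e //|nope].
have := gprime_Fermat gp nda; rewrite mulnC exprM.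
set z := a ^+ _ in nope *.
have nope' i (hi : (i < 4)%N) : dvdg nu (z - gI ^+ i) = false := nope (Ordinal hi).
have -> : z ^+ 4 - 1 = (z - gI ^+ 0) * (z - gI ^+ 1) * ((z - gI ^+ 2) * (z - gI ^+ 3)).
  rewrite (_ : gI ^+ 2 = -1) // (_ : gI ^+ 3 = - gI) // !expr0 expr1.
  have -> : (z - 1) * (z - gI) * ((z - -1) * (z - - gI)) = (z ^+ 2 - 1) * (z ^+ 2 - gI * gI) by ring.
  by rewrite gI2; ring.
by rewrite !gprime_EuclidE // (nope' 0) ?(nope' 1) ?(nope' 2) ?(nope' 3).
Qed.

Lemma qsym_uniq (a z : gint) : z \in qvals -> dvdg nu (a ^+ qexp nu - z) -> qsym nu a = z.
Proof.
move=> hz h; apply: (qvals_inj gp) => //; first exact: qsym_val.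
by apply: (dvdg_trans_mod nz _ h); rewrite dvdg_sym ?qsym_spec.
Qed.

Lemma qsym_eq0 (a : gint) : (qsym nu a == 0) = dvdg nu a.
Proof.
apply/eqP/idP => [h|/qsym_dvd //].
by have := qsym_spec a; rewrite h subr0 => /gprimeX.
Qed.

Lemma qsym_unit (a : gint) : ~~ dvdg nu a -> qsym nu a \in qunits.
Proof. by rewrite -qsym_eq0; have := qsym_val nu a; rewrite inE => /orP[->|]. Qed.

Lemma qsymM (a b : gint) : qsym nu (a * b) = qsym nu a * qsym nu b.
Proof.
apply: qsym_uniq; first by rewrite qvalsM ?qsym_val.
by rewrite exprMn dvdg_modM ?qsym_spec.
Qed.

Lemma qsym_cong (a b : gint) : dvdg nu (a - b) -> qsym nu a = qsym nu b.
Proof.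
move=> h; apply: qsym_uniq; first exact: qsym_val.
exact: (dvdg_trans_mod nz (dvdg_modX nz _ h) (qsym_spec b)).
Qed.

Lemma qsym1 : qsym nu 1 = 1.
Proof. by apply: qsym_uniq; rewrite // expr1n subrr dvdg0. Qed.

Lemma qsym_I : qsym nu gI = gI ^+ qexp nu.
Proof. by apply: qsym_uniq; rewrite ?qunits_vals ?qunits_I // subrr dvdg0. Qed.

End qsyms.

Lemma qsym_conj nu (a : gint) : gprime nu -> qsym (gconj nu) (gconj a) = gconj (qsym nu a).
Proof.
move=> gp; apply: (qsym_uniq (gprime_conj gp)).
  by have := qsym_val nu a; rewrite !inE => /or4P[||| /orP[]] /eqP->.
rewrite /qexp gnorm_conj -rmorphXn -rmorphB dvdg_conj ?gprime_nz //.
exact: qsym_spec.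
Qed.

(** For an inert prime [l], the exponent [(l ^ 2 - 1) / 4] is a multiple of [l - 1]. *)
Lemma qsym_inert_int nu (n : int) : gprime nu -> inert_prime nu -> ~~ dvdg nu n%:~R ->
  qsym nu n%:~R = 1.
Proof.
move=> gp [l pr [l3 nuE]] nd; have nz := gprime_nz gp.
have h : dvdg nu (n%:~R ^+ l.-1 - 1).
  have hl : dvdg nu (l%:Z%:~R) by rewrite nuE dvdg_natN ?prime_gt0 // !gE dvdzz dvdz0.
  have l0 : l%:Z != 0 by have := prime_gt0 pr; lia.
  have hn : dvdg nu (n%:~R - `|(n %% l)%Z|%N%:R).
    rewrite -[_%:R]/((`|(n %% l)%Z|%N)%:Z%:~R) gez0_abs ?modz_ge0 // -rmorphB /=.
    by apply: (dvdg_dvdz nz hl); rewrite {1}(divz_eq n l) addrK dvdz_mull.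
  apply: (dvdg_trans_mod nz (dvdg_modX nz _ hn)).
  apply: nat_Fermat_dvdg => //; apply/negP => h; move/negP: nd; apply.
  rewrite (dvdg_addr nz hn).
  by apply: (dvdg_dvdz nz (m := l) (n := `|(n %% l)%Z|%N) hl); rewrite dvdzE.
apply: qsym_uniq => //.
have -> : qexp nu = (l.-1 * (l.+1 %/ 4))%N.
  rewrite /qexp nuE gnorm_int sqrrN abszX /=.
  have -> : (l ^ 2).-1 = (l.-1 * (l.+1 %/ 4) * 4)%N.
    have [q lE] : exists q, l = (4 * q + 3)%N by exists (l %/ 4)%N; lia.
    have -> : (l.+1 %/ 4 = q.+1)%N by lia.
    by rewrite lE -mulnn; clear; lia.
  by rewrite mulnK.
by rewrite exprM -[X in _ - X](expr1n _ (l.+1 %/ 4)%N); apply: dvdg_modX.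
Qed.

(** * Composite moduli, given by a list of primes *)

Definition qsyms (ps : seq gint) (a : gint) : gint := \prod_(nu <- ps) qsym nu a.
Definition gprod (ps : seq gint) : gint := \prod_(nu <- ps) nu.
Definition gprimes (ps : seq gint) : Prop := forall nu, nu \in ps -> gprime nu.

Lemma gprimes_cons nu ps : gprimes (nu :: ps) <-> gprime nu /\ gprimes ps.
Proof.
split=> [h|[h1 h2] mu]; last by rewrite inE => /predU1P[->|/h2].
by split=> [|mu hm]; apply: h; rewrite inE ?eqxx ?hm ?orbT.
Qed.

Lemma gprimes1 nu : gprime nu -> gprimes [:: nu].
Proof. by move=> h mu; rewrite inE => /eqP->. Qed.

Lemma gprimes_cat ps qs : gprimes (ps ++ qs) <-> gprimes ps /\ gprimes qs.
Proof.
split=> [h|[h1 h2] mu]; last by rewrite mem_cat => /orP[/h1|/h2].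
by split=> mu hm; apply: h; rewrite mem_cat hm ?orbT.
Qed.

Lemma gprimes_conj ps : gprimes ps -> gprimes (map gconj ps).
Proof. by move=> h _ /mapP[nu /h gp ->]; apply: gprime_conj. Qed.

Lemma gprod_conj ps : gprod (map gconj ps) = gconj (gprod ps).
Proof. by rewrite /gprod big_map rmorph_prod. Qed.

Lemma gprod_cat ps qs : gprod (ps ++ qs) = gprod ps * gprod qs.
Proof. exact: big_cat. Qed.

Lemma gprod_primary ps : gprimes ps -> primary (gprod ps).
Proof.
rewrite /gprod; elim: ps => [|nu ps IH]; rewrite ?big_nil ?big_cons //.
by move=> /gprimes_cons[[pn _] /IH]; apply: primaryM.
Qed.

Lemma gprod_neq0 ps : gprimes ps -> gprod ps != 0.
Proof.
move=> /gprod_primary /primary_norm h; apply/eqP => e0.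
by move: h; rewrite e0.
Qed.

Lemma qsyms_cat ps qs (a : gint) : qsyms (ps ++ qs) a = qsyms ps a * qsyms qs a.
Proof. exact: big_cat. Qed.

Lemma qsyms_cons nu ps (a : gint) : qsyms (nu :: ps) a = qsym nu a * qsyms ps a.
Proof. exact: big_cons. Qed.

Lemma qsyms_seq1 nu (a : gint) : qsyms [:: nu] a = qsym nu a.
Proof. by rewrite /qsyms big_seq1. Qed.

Lemma dvdg_gprod ps nu (a : gint) : gprimes ps -> nu \in ps -> dvdg (gprod ps) a -> dvdg nu a.
Proof.
move=> gps hn /dvdgP-/(_ (gprod_neq0 gps))[c ->]; rewrite /gprod (big_rem nu) //=.
have nz := gprime_nz (gps nu hn).
by rewrite -mulrA dvdgMr ?dvdg_refl.
Qed.

Section qsymsSeq.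
Variable ps : seq gint.
Hypothesis gps : gprimes ps.

Lemma qsymsM (a b : gint) : qsyms ps (a * b) = qsyms ps a * qsyms ps b.
Proof. by rewrite /qsyms -big_split /= !big_seq; apply: eq_bigr => nu /gps gp; apply: qsymM. Qed.

Lemma qsyms1 : qsyms ps 1 = 1.
Proof. by rewrite /qsyms big_seq big1 // => nu /gps gp; apply: qsym1. Qed.

Lemma qsymsX (a : gint) n : qsyms ps (a ^+ n) = qsyms ps a ^+ n.
Proof. by elim: n => [|n IH]; rewrite ?qsyms1 // !exprS qsymsM IH. Qed.

Lemma qsyms_cong_all (a b : gint) : (forall nu, nu \in ps -> dvdg nu (a - b)) -> qsyms ps a = qsyms ps b.
Proof.
move=> h; rewrite /qsyms !big_seq; apply: eq_bigr => nu hn.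
by apply: (qsym_cong (gps hn)); apply: h.
Qed.

Lemma qsyms_cong (a b : gint) : dvdg (gprod ps) (a - b) -> qsyms ps a = qsyms ps b.
Proof. by move=> h; apply: qsyms_cong_all => nu hn; apply: (dvdg_gprod gps). Qed.

Lemma qsyms_unit (a : gint) : (forall nu, nu \in ps -> ~~ dvdg nu a) -> qsyms ps a \in qunits.
Proof.
move=> h; rewrite /qsyms big_seq; elim/big_ind: _ => //; first exact: qunitsM.
by move=> nu hn; apply: (qsym_unit (gps hn)); apply: h.
Qed.

End qsymsSeq.

Lemma qsyms_I ps : gprimes ps -> qsyms ps gI = gI ^+ (`|gnorm (gprod ps)|%N.-1 %/ 4).
Proof.
elim: ps => [|nu ps IH]; first by rewrite /qsyms /gprod !big_nil.
move=> /gprimes_cons[gp gps]; rewrite qsyms_cons qsym_I // IH // -exprD /gprod big_cons gnormM abszM.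
have [qE _] := gprime_qexp gp; rewrite qE -/(gprod ps).
have := primary_norm (gprod_primary gps); rewrite -(absz_gnorm (gprod ps)).
have := gprod_neq0 gps; rewrite -gnorm_eq0 -(absz_gnorm (gprod ps)).
move: `|gnorm (gprod ps)|%N (qexp nu) => N q N0 hN.
have [m ->] : exists m, N = (4 * m).+1 by exists (N.-1 %/ 4)%N; lia.
rewrite (_ : ((4 * q).+1 * (4 * m).+1).-1 = (q + m + 4 * (q * m)) * 4)%N; last by lia.
rewrite mulnK // (_ : (4 * m).+1.-1 = m * 4)%N; last by lia.
by rewrite mulnK // [RHS]exprD gI4 mulr1.
Qed.

(** * Factorization into primary primes *)

Lemma primary_unit (a : gint) : odd `|gnorm a|%N -> exists2 e, e \in qunits & primary (e * a).
Proof.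
case: a => u v od.
have : (2 %| u + v - 1)%Z by move: od; rewrite /gnorm /=; nia.
move=> h; have [v2|v2] := boolP (2 %| v)%Z.
  have [h4|h4] := boolP (4 %| u + v - 1)%Z.
    by exists 1 => //; rewrite mul1r /primary v2.
  by exists (-1) => //; rewrite /primary !gE /=; lia.
have [h4|h4] := boolP (4 %| u - v - 1)%Z.
  by exists gI => //; rewrite /primary !gE /=; lia.
by exists (- gI) => //; rewrite /primary !gE /=; lia.
Qed.

(** The polynomial [X ^ j - 1] has at most [j] roots. *)
Lemma Fp_nonunit_power p j : prime p -> (0 < j < p.-1)%N ->
  exists2 z : 'F_p, z != 0 & z ^+ j != 1.
Proof.
move=> pr /andP[j0 jp].
have [/existsP[z /andP[]]|] := boolP [exists z : 'F_p, (z != 0) && (z ^+ j != 1)]; first by exists z.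
rewrite negb_exists => /forallP h; exfalso.
pose s := enum (predC1 (0 : 'F_p)).
have q0 : 'X^j - 1 != 0 :> {poly 'F_p} by rewrite -size_poly_eq0 size_XnsubC.
have := max_poly_roots (rs := s) q0; rewrite size_XnsubC //.
have -> : all (root ('X^j - 1)) s.
  apply/allP => z; rewrite mem_enum => z0.
  have := h z; rewrite [z != 0]z0 /= negbK => /eqP zj.
  by rewrite /root !hornerE zj subrr.
rewrite enum_uniq => /(_ isT isT).
have : size s = p.-1 by rewrite -cardE cardC1 card_Fp.
by move=> ->; move: jp; clear; lia.
Qed.

Lemma Fp_nonresidue p : prime p -> (p %% 4 = 1)%N ->
  exists2 z : 'F_p, z != 0 & z ^+ (2 * (p %/ 4)) = -1.
Proof.
move=> pr p4; set k := (p %/ 4)%N.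
have pE : p = (4 * k).+1 by rewrite /k; lia.
have [|z z0 zk] := @Fp_nonunit_power p (2 * k) pr; first by have := prime_gt1 pr; lia.
exists z => //; have zp : z ^+ (4 * k) = 1.
  have cE : #|'F_p| = (4 * k).+1 by rewrite card_Fp.
  have := expf_card z; rewrite cE exprS -[RHS]mulr1.
  exact: mulfI.
apply/eqP; rewrite -addr_eq0; have : (z ^+ (2 * k) - 1) * (z ^+ (2 * k) + 1) = 0.
  transitivity (z ^+ (4 * k) - 1); last by rewrite zp subrr.
  rewrite (_ : 4 * k = 2 * k + 2 * k)%N; last by lia.
  by rewrite exprD; ring.
by move/eqP; rewrite mulf_eq0 subr_eq0 (negPf zk).
Qed.

Lemma sqrt_minus1 p : prime p -> (p %% 4 = 1)%N -> exists t : nat, (p %| t ^ 2 + 1)%N.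
Proof.
move=> pr p4; have [z _ zm] := Fp_nonresidue pr p4.
exists (nat_of_ord (z ^+ (p %/ 4))).
by rewrite (dvdn_pcharf (pchar_Fp pr)) natrD natrX natr_Zp -exprM mulnC zm addNr.
Qed.

Lemma nat_sqrt (n : nat) : exists s : nat, (s ^ 2 <= n < s.+1 ^ 2)%N.
Proof.
elim: n => [|n [s /andP[h1 h2]]]; first by exists 0%N.
have [h|h] := leqP (s.+1 ^ 2) n.+1; first by exists s.+1; rewrite h /=; lia.
by exists s; rewrite h andbT; lia.
Qed.

(** Thue's argument: with [s ^ 2 < p < (s + 1) ^ 2] and [t ^ 2 = -1], two of the values
[a + b t], for [0 <= a, b <= s], coincide modulo [p], which yields a nonzero multiple
[u ^ 2 + v ^ 2] of [p] smaller than [2 p]. *)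
Lemma two_squares p : prime p -> (p %% 4 = 1)%N -> exists a : gint, gnorm a = p.
Proof.
move=> pr p4; have [t ht] := sqrt_minus1 pr p4; have [s /andP[s1 s2]] := nat_sqrt p.
have {}s1 : (s ^ 2 < p)%N.
  rewrite ltn_neqAle s1 andbT; apply/eqP => sE; move: pr; rewrite -sE -mulnn => pr.
  have d : (s %| s * s)%N by apply: dvdn_mulr.
  have := prime_gt1 pr; have/primeP[_ /(_ s d)] := pr; case/orP => /eqP; nia.
pose f (x : 'I_s.+1 * 'I_s.+1) : 'F_p := (x.1 + x.2 * t)%N%:R.
have : ~ injective f.
  move=> inj; have := leq_card f inj; rewrite card_prod card_Fp // !card_ord.
  by move: s2; rewrite -mulnn; lia.
move=> ninj; have : exists x y, (x != y) && (f x == f y).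
  have [/'exists_existsP[x [y h]]|] := boolP [exists x, exists y, (x != y) && (f x == f y)].
    by exists x, y.
  rewrite negb_exists => /forallP h; case: ninj => x y fxy; apply/eqP.
  apply: contraT => xy; have := h x; rewrite negb_exists => /forallP/(_ y).
  by rewrite xy fxy eqxx.
case=> -[a b] [[c d] /andP[ne /eqP eq_f]].
pose u := a%:Z - c%:Z; pose v := b%:Z - d%:Z.
have ch : p \in [pchar 'F_p] by apply: pchar_Fp.
have puv : (p%:Z %| u + v * t)%Z.
  rewrite (dvdz_pcharf ch) /u /v rmorphD rmorphM !rmorphB /=.
  move: eq_f; rewrite /f /= !natrD !natrM => eq_f.
  have -> : a%:R - c%:R + (b%:R - d%:R) * t%:R = (a%:R + b%:R * t%:R) - (c%:R + d%:R * t%:R) :> 'F_p by ring.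
  by rewrite eq_f subrr.
have pN : (p%:Z %| gnorm (GInt u v))%Z.
  have -> : gnorm (GInt u v) = (u + v * t) * (u - v * t) + v ^+ 2 * (t ^ 2 + 1)%N%:Z.
    by rewrite /gnorm /= PoszD -PoszX; ring.
  by apply: rpredD; [apply: dvdz_mulr | apply: dvdz_mull; rewrite dvdzE].
have Nlt : gnorm (GInt u v) < p%:Z * 2.
  have := ltn_ord a; have := ltn_ord b; have := ltn_ord c; have := ltn_ord d.
  rewrite /gnorm /= /u /v; move: s1; rewrite -mulnn; clear; nia.
have N0 : gnorm (GInt u v) != 0.
  rewrite gnorm_eq0; apply: contraNneq ne => -[hu hv].
  by rewrite !xpair_eqE -!val_eqE /=; move: hu hv; rewrite /u /v; clear; lia.
have Ng := gnorm_ge0 (GInt u v).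
exists (GInt u v); have p0 : 0 < p%:Z by have := prime_gt0 pr.
move: pN Nlt N0 Ng => /dvdzP[q ->]; rewrite [_ * 2]mulrC ltr_pM2r // mulf_eq0 negb_or.
move=> q2 /andP[q0 _]; rewrite pmulr_lge0 // => q1.
by rewrite (_ : q = 1) ?mul1r //; move: q0 q1 q2; clear; lia.
Qed.

Lemma split_exists p : prime p -> (p %% 4 = 1)%N ->
  exists nu, [/\ gprime nu, split_prime nu & gnorm nu = p].
Proof.
move=> pr p4; have [a aN] := two_squares pr p4.
have [|e he pe] := primary_unit (a := a).
  by rewrite aN /=; lia.
exists (e * a); have N : gnorm (e * a) = p by rewrite gnormM aN qunits_norm // mul1r.
by split=> //; [split=> //; left|]; rewrite /split_prime N.
Qed.

(** Multiply by the conjugate of [a]: its norm is 1 modulo 4. *)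
Lemma primary_divl (a b : gint) : primary a -> primary (a * b) -> primary b.
Proof.
move=> pa pab; have N4 := primary_norm pa.
have : primary ((gnorm a)%:~R * b).
  by rewrite gnormE mulrAC mulrC primaryM // primary_conj.
case: b {pab} => u v; rewrite /primary !gE /=; move: N4 => /dvdzP[k hk].
have -> : gnorm a = 4 * k + 1 by lia.
by rewrite !mul0r subr0 addr0; lia.
Qed.

Lemma primary_norm1 (a : gint) : primary a -> gnorm a = 1 -> a = 1.
Proof.
case: a => u v; rewrite /primary /gnorm /= => /andP[/dvdzP[e ->] h4] h.
have e0 : e = 0 by move: h; clear; nia.
have : u ^+ 2 == 1 by move: h; rewrite e0; clear; lia.
by rewrite sqrf_eq1 => /orP[] /eqP uE; move: h4; rewrite e0 uE.
Qed.

(** A rational prime divisor of the norm either is inert, and then divides [a], or is the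
norm of some [nu], and then [nu] or its conjugate divides [a]. *)
Lemma gprime_divisor (a : gint) : primary a -> 1 < gnorm a -> exists2 nu, gprime nu & dvdg nu a.
Proof.
move=> pa N1; have N4 := primary_norm pa.
pose l := pdiv `|gnorm a|%N.
have pr : prime l by apply: pdiv_prime; have := absz_gnorm a; lia.
have dl : (l%:Z %| gnorm a)%Z by rewrite dvdzE; apply: pdiv_dvd.
have lodd : odd l.
  apply/negPn/negP => le; have : (2%:Z %| gnorm a)%Z by apply: dvdz_trans dl; rewrite dvdzE /=; lia.
  by move: N4; clear; lia.
have [l3|l1] : (l %% 4 = 3)%N \/ (l %% 4 = 1)%N by lia.
  exists (- l%:Z)%:~R; first by split; [rewrite /primary !gE; lia|right; exists l].
  rewrite dvdg_natN ?prime_gt0 //.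
  by rewrite (sum_sqr_dvd3 pr l3 dl) (@sum_sqr_dvd3 l _ (gre a)) // addrC.
have [nu [gp sp Nnu]] := split_exists pr l1.
have nz := gprime_nz gp.
have : dvdg nu (a * gconj a).
  by rewrite -gnormE; apply: (dvdg_dvdz nz (dvdg_normr nz)); rewrite Nnu.
case/(gprime_Euclid gp)/orP => h; first by exists nu.
exists (gconj nu); first exact: gprime_conj.
by rewrite -[a]gconjK dvdg_conj.
Qed.

Lemma primary_factor (a : gint) : primary a -> exists2 ps, gprimes ps & gprod ps = a.
Proof.
have [n] := ubnP `|gnorm a|%N; elim: n a => // n IH a lt_n pa.
have N4 := primary_norm pa; have N0 := gnorm_ge0 a.
have [N1|N1] := leP (gnorm a) 1.
  exists [::] => //; rewrite /gprod big_nil; symmetry; apply: primary_norm1 => //.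
  by move: N0 N1 N4; clear; lia.
have [nu gp dv] := gprime_divisor pa N1; have nz := gprime_nz gp.
have [b aE] := dvdgP _ nz dv.
have pb : primary b by apply: (@primary_divl nu); rewrite -?aE //; case: gp.
have [||ps gps psE] := IH b => //.
  have nu2 : (1 < `|gnorm nu|)%N by rewrite -ltz_nat absz_gnorm gprime_norm_gt1.
  have a1 : (0 < `|gnorm a|)%N by rewrite absz_gt0; move: N1; clear; lia.
  move: lt_n a1; rewrite aE gnormM abszM ltnS muln_gt0 => lt_n /andP[_ b0].
  by apply: leq_trans lt_n; rewrite ltn_Pmull.
exists (nu :: ps); first by apply/gprimes_cons.
by rewrite /gprod big_cons -/(gprod ps) psE.
Qed.

(** * Gauss and Jacobi sums *)

Section GaussSum.
Variables (p : nat) (z : algC).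
Hypotheses (pr : prime p) (zp : p.-primitive_root z).

Definition expchar (x : 'F_p) : algC := z ^+ x.

Lemma expchar_nat (n : nat) : expchar n%:R = z ^+ n.
Proof. by rewrite /expchar val_Fp_nat // (prim_expr_mod zp). Qed.

Lemma expcharD x y : expchar (x + y) = expchar x * expchar y.
Proof. by rewrite -{1}(natr_Zp x) -{1}(natr_Zp y) -natrD expchar_nat exprD. Qed.

Lemma expcharX x n : expchar x ^+ n = expchar (n%:R * x).
Proof. by rewrite -{2}(natr_Zp x) -natrM expchar_nat mulnC exprM. Qed.

Lemma sum_expchar : \sum_x expchar x = 0.
Proof.
have : expchar 1 * \sum_x expchar x = \sum_x expchar x.
  rewrite mulr_sumr [RHS](reindex_inj (addrI (1 : 'F_p))) /=.
  by apply: eq_bigr => x _; rewrite expcharD.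
move/eqP; rewrite -subr_eq0 -{2}[\sum_x _]mul1r -mulrBl mulf_eq0 subr_eq0 => /orP[h|/eqP //].
move: h; rewrite -[1 : 'F_p]/(1%:R) expchar_nat expr1 => /eqP z1.
by have := prim_order_dvd zp 1; rewrite expr1 z1 eqxx dvdn1; have := prime_gt1 pr; lia.
Qed.

Record mulchar (f : 'F_p -> algC) : Prop := MulChar {
  mulchar0 : f 0 = 0;
  mulchar1 : f 1 = 1;
  mulcharM : forall x y, f (x * y) = f x * f y }.

Definition gauss (f : 'F_p -> algC) : algC := \sum_x f x * expchar x.
Definition jacobi (f g : 'F_p -> algC) : algC := \sum_x f x * g (1 - x).

Lemma sum_mulchar f (t : 'F_p) : mulchar f -> t != 0 -> f t != 1 -> \sum_x f x = 0.
Proof.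
move=> mf t0 ft; have : f t * \sum_x f x = \sum_x f x.
  rewrite mulr_sumr [RHS](reindex_inj (mulfI t0)) /=.
  by apply: eq_bigr => x _; rewrite (mulcharM mf).
by move/eqP; rewrite -subr_eq0 -{2}[\sum_x _]mul1r -mulrBl mulf_eq0 subr_eq0 (negPf ft) => /eqP.
Qed.

Lemma conv_mulchar f g (s : 'F_p) : mulchar f -> mulchar g -> s != 0 ->
  \sum_x f x * g (s - x) = f s * g s * jacobi f g.
Proof.
move=> mf mg s0; rewrite (reindex_inj (mulfI s0)) /= /jacobi mulr_sumr.
apply: eq_bigr => x _; rewrite -{2}[s]mulr1 -mulrBr (mulcharM mf) (mulcharM mg); ring.
Qed.

Lemma conv_mulchar0 f g : mulchar f -> mulchar g ->
  \sum_x f x * g (0 - x) = g (-1) * \sum_x f x * g x.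
Proof.
move=> mf mg; rewrite mulr_sumr; apply: eq_bigr => x _.
have -> : 0 - x = -1 * x by rewrite sub0r mulN1r.
by rewrite (mulcharM mg) mulrCA.
Qed.

(** Group the terms of the product according to the sum [s] of the two indices. *)
Lemma gaussM f g : gauss f * gauss g = \sum_s expchar s * \sum_x f x * g (s - x).
Proof.
rewrite /gauss mulr_suml.
transitivity (\sum_x \sum_s f x * expchar s * g (s - x)).
  apply: eq_bigr => x _; rewrite mulr_sumr [RHS](reindex_inj (addrI x)) /=.
  by apply: eq_bigr => y _; rewrite expcharD [x + y]addrC addrK; ring.
rewrite exchange_big /=; apply: eq_bigr => s _; rewrite mulr_sumr.
by apply: eq_bigr => x _; ring.
Qed.

Lemma gauss_mul f g : mulchar f -> mulchar g -> \sum_x f x * g x = 0 ->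
  gauss f * gauss g = jacobi f g * gauss (fun x => f x * g x).
Proof.
move=> mf mg sfg; rewrite gaussM /gauss mulr_sumr.
apply: eq_bigr => s _; have [->|s0] := eqVneq s 0.
  by rewrite conv_mulchar0 // sfg (mulchar0 mf) !(mulr0, mul0r).
by rewrite conv_mulchar //; ring.
Qed.

(** The convolution of [f] and [g] has the constant value [jacobi f g] at nonzero [s] and
its sum over all [s] is 0, which determines [jacobi f g]. *)
Lemma gauss_mulV f g : mulchar f -> mulchar g -> (forall x, x != 0 -> f x * g x = 1) ->
  \sum_x f x = 0 -> gauss f * gauss g = g (-1) * p%:R.
Proof.
move=> mf mg fg1 sf.
have cp : #|'F_p| = p by rewrite card_Fp.
have ones : \sum_x f x * g x = p%:R - 1.
  rewrite (bigD1 0) //= (mulchar0 mf) mul0r add0r (eq_bigr (fun => 1)); last by move=> x /fg1.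
  rewrite sumr_const.
  have -> : #|[pred s : 'F_p | s != 0]| = p.-1 by rewrite (cardC1 (0 : 'F_p)) cp.
  by rewrite -subn1 natrB ?prime_gt0.
have p1 : p%:R - 1 != 0 :> algC.
  by rewrite subr_eq0 pnatr_eq1; have := prime_gt1 pr; lia.
have JE : jacobi f g = - g (-1).
  have : \sum_s \sum_x f x * g (s - x) = 0.
    transitivity ((\sum_x f x) * \sum_y g y); last by rewrite sf mul0r.
    rewrite mulr_suml exchange_big /=; apply: eq_bigr => x _.
    rewrite -mulr_sumr (reindex_inj (addrI x)) /=; congr (_ * _).
    by apply: eq_bigr => y _; rewrite addrC addKr.
  rewrite (bigD1 0) //= conv_mulchar0 // ones (eq_bigr (fun => jacobi f g)); last first.
    by move=> s s0; rewrite conv_mulchar // fg1 // mul1r.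
  rewrite sumr_const -[X in _ + X]mulr_natl.
  have -> : #|[pred s : 'F_p | s != 0]| = p.-1 by rewrite (cardC1 (0 : 'F_p)) cp.
  rewrite -subn1 natrB ?prime_gt0 // mulrC -mulrDr => /eqP.
  by rewrite mulf_eq0 (negPf p1) addrC addr_eq0 => /eqP.
rewrite gaussM (bigD1 0) //= conv_mulchar0 // ones.
rewrite (eq_bigr (fun s => expchar s * - g (-1))); last first.
  by move=> s s0; rewrite conv_mulchar // fg1 // mul1r JE.
rewrite -mulr_suml.
have -> : \sum_(s | s != 0) expchar s = -1.
  have := sum_expchar; rewrite (bigD1 0) //= addrC {2}/expchar expr0 => /eqP.
  by rewrite addr_eq0 => /eqP.
by rewrite /expchar expr0; ring.
Qed.
End GaussSum.

Definition toC (a : gint) : algC := (gre a)%:~R + (gim a)%:~R * 'i.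

Fact toC_is_additive : zmod_morphism toC.
Proof. by move=> a b; rewrite /toC !gE !rmorphB; ring. Qed.
HB.instance Definition _ := GRing.isZmodMorphism.Build gint algC toC toC_is_additive.
Fact toC_is_multiplicative : monoid_morphism toC.
Proof.
split=> [|a b]; rewrite /toC !gE ?mul0r ?addr0 //.
rewrite rmorphB rmorphD !rmorphM /=.
have -> : forall u v u' v' : algC, (u + v * 'i) * (u' + v' * 'i) =
   u * u' + v * v' * 'i ^+ 2 + (u * v' + v * u') * 'i by move=> *; ring.
by rewrite sqrCi; ring.
Qed.
HB.instance Definition _ :=
  GRing.isMonoidMorphism.Build gint algC toC toC_is_multiplicative.

Lemma toC_conj (a : gint) : toC (gconj a) = (toC a)^*.
Proof.
rewrite /toC /= rmorphD rmorphM /= !rmorph_int conjCi rmorphN /=; ring.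
Qed.

Lemma toC_norm (a : gint) : (gnorm a)%:~R = toC a * (toC a)^*.
Proof. by rewrite -toC_conj -rmorphM -gnormE rmorph_int. Qed.

Lemma toC_inj : injective toC.
Proof.
move=> a b /eqP; rewrite -subr_eq0 -rmorphB => /eqP ab0; apply/eqP.
have := toC_norm (a - b); rewrite ab0 mul0r => /eqP.
by rewrite intr_eq0 gnorm_eq0 subr_eq0.
Qed.

Lemma toC_Aint (a : gint) : toC a \in Aint.
Proof.
rewrite rpredD ?rpredM ?Aint_int //.
apply: (@Aint_unity_root 4) => //; apply/unity_rootP.
by rewrite -[4%N]/(2 * 2)%N exprM sqrCi sqrrN expr1n.
Qed.

(** Congruence modulo [l] in the ring of algebraic integers. *)
Definition Amod (l : nat) (x y : algC) : Prop := exists2 t, t \in Aint & x = y + l%:R * t.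


Lemma AmodMl l a x y : a \in Aint -> Amod l x y -> Amod l (a * x) (a * y).
Proof. by move=> ha [t ht ->]; exists (a * t); rewrite ?rpredM //; ring. Qed.


Lemma Amod_sumX l (I : finType) (F : I -> algC) : prime l -> (forall i, F i \in Aint) ->
  Amod l ((\sum_i F i) ^+ l) (\sum_i F i ^+ l).
Proof.
move=> pr FA; suff [] : Amod l ((\sum_i F i) ^+ l) (\sum_i F i ^+ l) /\ \sum_i F i \in Aint by [].
elim/big_rec2: _ => [|i x y _ [[t ht yE] xA]].
  by split=> //; exists 0 => //; rewrite expr0n; case: l pr => // l _; rewrite mulr0 addr0.
split; last by rewrite rpredD.
exists (t + frob_defect l (F i) y); last by rewrite exprD_prime // yE; ring.
rewrite rpredD // rpred_sum // => j _.
by rewrite !rpredM ?rpredX ?rpred_nat.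
Qed.

(** If [c / l] is an algebraic integer, its trace [2 Re (c) / l] is a rational one, hence an
integer; the same holds for [- i c]. *)
Lemma Amod_toC l (a b : gint) : odd l -> (0 < l)%N -> Amod l (toC a) (toC b) -> dvdg l%:R (a - b).
Proof.
move=> lo l0 [t ht]; move/(canLR (addKr _)); rewrite addrC -rmorphB.
move: (a - b) => {a b} c; move=> cE.
have key (d : gint) s : s \in Aint -> toC d = l%:R * s -> (l%:Z %| gre d)%Z.
  move=> hs dE.
  have dE' : toC (gconj d) = l%:R * s^*.
    by rewrite toC_conj dE rmorphM rmorph_nat.
  have sum : (gre d * 2)%:~R = l%:R * (s + s^*).
    rewrite [RHS]mulrDr -dE -dE' /toC /= rmorphN rmorphM /=; ring.
  have ln0 : l%:R != 0 :> algC by rewrite pnatr_eq0; lia.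
  have sE : s + s^* = (gre d * 2)%:~R / l%:R by rewrite sum mulrC mulKf.
  have : s + s^* \in Num.int.
    apply: Cint_rat_Aint; first by rewrite sE rpred_div ?rpred_int ?rpred_nat.
    by rewrite rpredD // Aint_aut.
  case/intrP => m mE; move: sum; rewrite mE -[l%:R]/(l%:Z%:~R) -rmorphM => /intr_inj h.
  have : (l%:Z %| gre d * 2)%Z by rewrite h dvdz_mulr.
  by rewrite Gauss_dvdzl // coprimezE /= coprimen2.
rewrite -[l%:R]/(l%:Z%:~R) dvdg_int; last by lia.
rewrite (key c t) //=.
have -> : gim c = gre (- gI * c) by rewrite !gE /=; ring.
have iE : toC gI = 'i by rewrite /toC /= mul1r add0r.
apply: (key _ (- 'i * t)); first by rewrite rpredM ?rpredN // -iE toC_Aint.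
by rewrite rmorphM rmorphN /= iE cE; ring.
Qed.

(** * The quartic Gauss sum *)

Section QuarticGauss.
Variables (nu : gint) (z : algC).
Hypotheses (gp : gprime nu) (sp : split_prime nu).
Let p := `|gnorm nu|%N.
Hypothesis zp : p.-primitive_root z.
Let nz := gprime_nz gp.

Let pr : prime p := sp.

Lemma split_norm_nat : (p%:Z : int) = gnorm nu.
Proof. exact: absz_gnorm. Qed.

Lemma split_qexp : p = (4 * qexp nu).+1.
Proof. by have [] := gprime_qexp gp. Qed.

Lemma split_dvdg_nat (n : nat) : dvdg nu n%:R = (p %| n)%N.
Proof. by rewrite -[n%:R]/(n%:Z%:~R) split_dvdg_int // -split_norm_nat dvdzE. Qed.

Lemma split_dvdgB (m n : nat) : (m = n %[mod p])%N -> dvdg nu (m%:R - n%:R).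
Proof.
wlog le_nm : m n / (n <= m)%N => [W h|h].
  by have [/W|/ltnW/W] := leqP n m; last rewrite dvdg_sym //; apply.
by rewrite -natrB // split_dvdg_nat -eqn_mod_dvd // h.
Qed.

(** The quartic character attached to [nu], with values in the Gaussian integers. *)
Definition qch (x : 'F_p) : gint := qsym nu (x : nat)%:R.

Lemma qch_nat (n : nat) : qch n%:R = qsym nu n%:R.
Proof. by rewrite /qch; apply: (qsym_cong gp); apply: split_dvdgB; rewrite val_Fp_nat // modn_mod. Qed.

Lemma qchM x y : qch (x * y) = qch x * qch y.
Proof.
by rewrite -{1}(natr_Zp x) -{1}(natr_Zp y) -natrM qch_nat natrM qsymM.
Qed.

Lemma qch0 : qch 0 = 0.
Proof. by rewrite /qch; apply: qsym_dvd => //; apply: dvdg0. Qed.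

Lemma qch1 : qch 1 = 1.
Proof. by rewrite -[1 : 'F_p]/(1%:R) qch_nat qsym1. Qed.

Lemma qch_unit x : x != 0 -> qch x \in qunits.
Proof.
move=> x0; apply: qsym_unit => //; rewrite split_dvdg_nat.
by rewrite (dvdn_pcharf (pchar_Fp pr)) natr_Zp.
Qed.


Definition chi (n : nat) (x : 'F_p) : algC := toC (qch x) ^+ n.

Lemma chi_mulchar n : (0 < n)%N -> mulchar (chi n).
Proof.
move=> n0; split; rewrite /chi ?qch0 ?qch1 ?rmorph0 ?rmorph1 ?expr0n ?expr1n //.
  by case: n n0.
by move=> x y; rewrite qchM rmorphM exprMn.
Qed.

Lemma chi4 x : x != 0 -> chi 4 x = 1.
Proof. by move=> x0; rewrite /chi -rmorphXn qunitsX4 ?qch_unit ?rmorph1. Qed.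

Lemma qch_nonresidue : exists2 t : 'F_p, t != 0 & qch t ^+ 2 = -1.
Proof.
have [|t t0 tk] := @Fp_nonresidue p pr; first by have := split_qexp; lia.
exists t => //; apply: (qvals_inj gp) => //.
  by rewrite qunits_vals // exprS expr1 qunitsM ?qch_unit.
have sp1 := qsym_spec gp (t : nat)%:R; rewrite -/(qch t) in sp1.
apply: (dvdg_trans_mod nz (b := (t : nat)%:R ^+ (2 * qexp nu))).
  by rewrite dvdg_sym // mulnC exprM; apply: dvdg_modX.
rewrite opprK -natrX -[1]/(1%:R) -natrD split_dvdg_nat (dvdn_pcharf (pchar_Fp pr)).
rewrite natrD natrX natr_Zp (_ : qexp nu = p %/ 4)%N ?tk ?addNr //.
by have := split_qexp; lia.
Qed.

Lemma sum_chi n : (0 < n < 4)%N -> \sum_x chi n x = 0.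
Proof.
move=> /andP[n0 n4]; have [t t0 t2] := qch_nonresidue.
apply: (sum_mulchar (t := t) (chi_mulchar n0)) => //; rewrite /chi -rmorphXn.
apply/eqP => h; have {h} : qch t ^+ n = 1 by apply: toC_inj; rewrite h rmorph1.
move: (qch_unit t0) t2; rewrite !inE => /or4P[] /eqP-> //.
all: by case: n n0 n4 => [|[|[|[|n]]]].
Qed.

Lemma chi3_conj x : chi 3 x = (chi 1 x)^*.
Proof.
rewrite /chi expr1 -toC_conj -rmorphXn; congr toC.
have [->|x0] := eqVneq x 0; first by rewrite qch0.
by rewrite -qunits_conjX ?qch_unit.
Qed.

Local Notation G n := (gauss z (chi n)).

Lemma gauss_ext f g : f =1 g -> gauss z f = gauss (p := p) z g.
Proof. by move=> fg; apply: eq_bigr => x _; rewrite fg. Qed.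

Definition Jg : gint := \sum_(x : 'F_p) qch x * qch (1 - x) ^+ 2.

Lemma jacobi12 : jacobi (chi 1) (chi 2) = toC Jg.
Proof.
rewrite /jacobi /Jg rmorph_sum; apply: eq_bigr => x _.
by rewrite /chi expr1 rmorphM rmorphXn.
Qed.

Lemma jacobi32 : jacobi (chi 3) (chi 2) = toC (gconj Jg).
Proof.
rewrite toC_conj -jacobi12 rmorph_sum; apply: eq_bigr => x _.
rewrite rmorphM /= chi3_conj; congr (_ * _); rewrite /chi rmorphXn /= -toC_conj -!rmorphXn; congr toC.
have [->|x0] := eqVneq (1 - x) 0; first by rewrite qch0.
rewrite rmorphXn /= qunits_conjX ?qch_unit // -exprM.
by rewrite (_ : 3 * 2 = 4 + 2)%N // exprD qunitsX4 ?mul1r ?qch_unit.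
Qed.

Lemma gauss12 : G 1 * G 2 = toC Jg * G 3.
Proof.
have S : \sum_x chi 1 x * chi 2 x = 0.
  by rewrite -[RHS](@sum_chi 3) //; apply: eq_bigr => x _; rewrite /chi -exprD.
rewrite (gauss_mul pr zp (@chi_mulchar 1 isT) (@chi_mulchar 2 isT) S) jacobi12.
by congr (_ * _); apply: gauss_ext => x; rewrite /chi -exprD.
Qed.

Lemma gauss32 : G 3 * G 2 = toC (gconj Jg) * G 1.
Proof.
have chi5 x : chi 3 x * chi 2 x = chi 1 x.
  rewrite /chi -exprD -!rmorphXn; congr toC.
  have [->|x0] := eqVneq x 0; first by rewrite qch0.
  by rewrite (exprD _ 4 1) qunitsX4 ?mul1r ?qch_unit.
have S : \sum_x chi 3 x * chi 2 x = 0.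
  by rewrite -[RHS](@sum_chi 1) //; apply: eq_bigr.
rewrite (gauss_mul pr zp (@chi_mulchar 3 isT) (@chi_mulchar 2 isT) S) jacobi32.
by congr (_ * _); apply: gauss_ext.
Qed.

Lemma chi_N1 : exists2 e : gint, qch (-1) = e & e * e = 1 /\ toC e * toC e = 1.
Proof.
exists (qch (-1)) => //; have h : qch (-1) * qch (-1) = 1 by rewrite -qchM mulrNN mul1r qch1.
by rewrite -rmorphM h rmorph1.
Qed.

Lemma gauss13 : G 1 * G 3 = toC (qch (-1)) * p%:R.
Proof.
rewrite (gauss_mulV pr zp) //; try exact: chi_mulchar; last exact: sum_chi.
  by have [e eE [_ e2]] := chi_N1; rewrite /chi eE !exprS expr0 mulr1 e2 mulr1.
by move=> x x0; rewrite -(chi4 x0) /chi -exprD.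
Qed.

Lemma gauss22 : G 2 * G 2 = p%:R.
Proof.
rewrite (gauss_mulV pr zp) //; try exact: chi_mulchar; last exact: sum_chi.
  by have [e eE [_ e2]] := chi_N1; rewrite /chi expr2 eE e2 mul1r.
by move=> x x0; rewrite -(chi4 x0) /chi -exprD.
Qed.

Lemma p_neq0 : p%:R != 0 :> algC.
Proof. by rewrite pnatr_eq0; have := prime_gt0 pr; lia. Qed.

Lemma gauss13_neq0 : G 1 * G 3 != 0.
Proof.
rewrite gauss13 mulf_neq0 ?p_neq0 //; have [e -> [_ e2]] := chi_N1.
by apply/eqP => e0; move: e2; rewrite e0 mul0r => /eqP; rewrite eq_sym oner_eq0.
Qed.

Lemma Jg_norm : gnorm Jg = p.
Proof.
apply: (@intr_inj algC); rewrite toC_norm -toC_conj -[RHS]/(p%:R).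
apply: (mulfI gauss13_neq0).
transitivity ((G 1 * G 2) * (G 3 * G 2)); first by rewrite gauss12 gauss32; ring.
by rewrite -gauss22; ring.
Qed.

(** One has [G 1 ^ 2 * G 2 = J * G 3 * G 1], where [J] is the Jacobi sum, and [G 2 ^ 2 = p]. *)
Lemma gauss_pow4 : G 1 ^+ 4 = toC Jg ^+ 2 * p%:R.
Proof.
have [e eE [_ e2]] := chi_N1.
apply: (mulIf p_neq0).
transitivity ((G 1 * (G 1 * G 2)) * (G 1 * (G 1 * G 2))); first by rewrite -gauss22; ring.
rewrite gauss12.
transitivity (toC Jg ^+ 2 * (G 1 * G 3) * (G 1 * G 3)); first by ring.
rewrite gauss13 eE -[RHS]mul1r -e2; ring.
Qed.

Lemma sum_qch n : (0 < n < 4)%N -> \sum_x qch x ^+ n = 0.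
Proof.
move=> hn; apply: toC_inj; rewrite rmorph_sum rmorph0 -[RHS](sum_chi hn).
by apply: eq_bigr => x _; rewrite rmorphXn.
Qed.

(** The product [(chi x - 1) (chi (1 - x) ^ 2 - 1)] is divisible by [2 + 2 i]
for every [x], and its sum is the Jacobi sum plus [p]. *)
Lemma Jg_primary : primary (- Jg).
Proof.
have key (x : 'F_p) : exists t, (qch x - 1) * (qch (1 - x) ^+ 2 - 1) = GInt 2 2 * t.
  have [->|x0] := eqVneq x 0; first by exists 0; rewrite subr0 qch1 qch0 expr1n subrr !mulr0.
  have [->|x1] := eqVneq x 1; first by exists 0; rewrite qch1 subrr mul0r mulr0.
  have x1' : 1 - x != 0 by rewrite subr_eq0 eq_sym.
  have := qch_unit x0; have := qch_unit x1'; rewrite !inE.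
  case/or4P => /eqP-> /or4P[] /eqP->; first [by exists 0 | by exists 1 | by exists (-1)
   | by exists gI | by exists (- gI) | by exists (GInt 1 1) | by exists (GInt 1 (-1))
   | by exists (GInt (-1) 1) | by exists (GInt (-1) (-1))].
have [T TE] : exists T, \sum_(x : 'F_p) (qch x - 1) * (qch (1 - x) ^+ 2 - 1) = GInt 2 2 * T.
  elim/big_rec: _ => [|x y _ [T ->]]; first by exists 0; rewrite mulr0.
  by have [t ->] := key x; exists (t + T); rewrite mulrDr.
have JE : \sum_(x : 'F_p) (qch x - 1) * (qch (1 - x) ^+ 2 - 1) = Jg + p%:R.
  transitivity (Jg - \sum_x qch x ^+ 1 - \sum_x qch (1 - x) ^+ 2 + \sum_(x : 'F_p) 1).
    rewrite /Jg -!sumrB -big_split /=; apply: eq_bigr => x _; rewrite expr1; ring.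
  rewrite sum_qch // (reindex_inj (inv_inj (subKr 1))) /=.
  under eq_bigr do rewrite subKr.
  by rewrite sum_qch // sumr_const card_Fp // !subr0.
have -> : - Jg = p%:R - GInt 2 2 * T by rewrite -TE JE; ring.
rewrite -[p%:R]/(p%:Z%:~R) split_qexp /primary !gE /=; lia.
Qed.

(** Modulo [nu] the Jacobi sum is the sum of the values on the prime field of a polynomial of
degree less than [p - 1], and such a sum vanishes. *)
Lemma Jg_dvd : dvdg nu Jg.
Proof.
pose k := qexp nu; have k0 : (0 < k)%N by have [] := gprime_qexp gp.
have h : dvdg nu (Jg - \sum_(x : 'F_p) ((x : nat) ^ k * ((1 - x)%R : nat) ^ (2 * k))%N%:R).
  rewrite /Jg -sumrB; elim/big_rec: _ => [|x y _ hy]; first exact: dvdg0.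
  apply: (dvdgD nz) => //; rewrite natrM !natrX dvdg_sym // (mulnC 2 k) exprM.
  apply: (dvdg_modM nz); first exact: qsym_spec.
  by apply: (dvdg_modX nz); apply: qsym_spec.
rewrite (dvdg_addr nz h) -natr_sum split_dvdg_nat (dvdn_pcharf (pchar_Fp pr)) natr_sum.
pose P : {poly 'F_p} := 'X^k * (1 - 'X) ^+ (2 * k).
have PE (x : 'F_p) : (((x : nat) ^ k * ((1 - x)%R : nat) ^ (2 * k))%N%:R : 'F_p) = P.[x].
  by rewrite natrM !natrX !natr_Zp /P !hornerE.
rewrite (eq_bigr _ (fun x _ => PE x)).
have sz : (size P <= p.-1)%N.
  apply: leq_trans (size_polyMleq _ _) _; rewrite size_polyXn.
  have := size_poly_exp_leq (1 - 'X : {poly 'F_p}) (2 * k).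
  have -> : size (1 - 'X : {poly 'F_p}) = 2%N by rewrite -opprB size_polyN size_XsubC.
  move: (size _) => m; rewrite mul1n => hm; rewrite split_qexp -/k.
  by move: hm k0; clear; lia.
rewrite (eq_bigr (fun x => \sum_(i < p.-1) P`_i * x ^+ i)); last first.
  by move=> x _; rewrite (horner_coef_wide _ sz).
rewrite exchange_big big1 //= => i _; rewrite -mulr_sumr.
suff -> : \sum_(x : 'F_p) x ^+ i = 0 by rewrite mulr0.
case: i => [[|i] hi] /=.
  by rewrite sumr_const card_Fp // -mulr_natl mulr1 pchar_Fp_0.
have [t t0 ti] := Fp_nonunit_power pr (j := i.+1) hi.
have : t ^+ i.+1 * \sum_(x : 'F_p) x ^+ i.+1 = \sum_(x : 'F_p) x ^+ i.+1.
  rewrite mulr_sumr [RHS](reindex_inj (mulfI t0)) /=.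
  by apply: eq_bigr => x _; rewrite exprMn.
by move/eqP; rewrite -subr_eq0 -{2}[\sum_x _]mul1r -mulrBl mulf_eq0 subr_eq0 (negPf ti) => /eqP.
Qed.

(** [- J] is primary, divisible by [nu], and has the same norm. *)
Lemma JgE : Jg = - nu.
Proof.
have [b JE] := dvdgP _ nz Jg_dvd.
have Nb : gnorm b = 1.
  have := Jg_norm; rewrite JE gnormM -split_norm_nat => h.
  by apply: (@mulfI _ p%:Z); rewrite ?mulr1 //; have := prime_gt0 pr; lia.
have : - b = 1.
  apply: primary_norm1; last by rewrite -mulN1r gnormM Nb.
  by apply: (@primary_divl nu); [case: gp | rewrite mulrN -JE Jg_primary].
by move/(congr1 -%R); rewrite opprK JE => ->; rewrite mulrN1.
Qed.

Lemma quartic_gauss_pow4 : G 1 ^+ 4 = toC (nu ^+ 3 * gconj nu).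
Proof.
rewrite gauss_pow4 JgE -[p%:R]/(p%:Z%:~R) split_norm_nat toC_norm -toC_conj.
by rewrite -rmorphXn -!rmorphM; congr toC; ring.
Qed.
End QuarticGauss.

(** * Quartic reciprocity *)

Section GaussFrobenius.
Variables (nu : gint) (z : algC) (l : nat).
Hypotheses (gp : gprime nu) (sp : split_prime nu).
Let p := `|gnorm nu|%N.
Hypotheses (zp : p.-primitive_root z) (prl : prime l) (lp : l != p).
Let pr : prime p := sp.

Local Notation chin n := (@chi nu n).
Local Notation G n := (gauss z (chin n)).

Lemma chi_Aint n x : chin n x \in Aint.
Proof. by rewrite rpredX ?toC_Aint. Qed.

Lemma expchar_Aint (x : 'F_p) : expchar z x \in Aint.
Proof. by rewrite rpredX ?(Aint_prim_root zp). Qed.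

Lemma gauss_Aint n : G n \in Aint.
Proof. by rewrite rpred_sum // => x _; rewrite rpredM ?chi_Aint ?expchar_Aint. Qed.

Lemma l_Fp_neq0 : l%:R != 0 :> 'F_p.
Proof. by rewrite -(dvdn_pcharf (pchar_Fp pr)) dvdn_prime2 // eq_sym. Qed.

(** The [l]-th power turns the additive character [e (x)] into [e (l x)]; the substitution
[x := x / l] then brings out the symbol of [l]. *)
Lemma gauss_Frobenius n : (forall x, chin 1 x ^+ l = chin n x) -> (0 < n)%N ->
  Amod l (toC (qsym nu l%:R) ^+ n * G 1 ^+ l) (G n).
Proof.
move=> hn n0.
have := @Amod_sumX l 'F_p (fun x => chin 1 x * expchar z x) prl.
rewrite -[\sum_i _]/(G 1) => h.
have [|t ht tE] := h; first by move=> x; rewrite rpredM ?chi_Aint ?expchar_Aint.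
exists (toC (qsym nu l%:R) ^+ n * t); first by rewrite rpredM ?rpredX ?toC_Aint.
rewrite tE mulrDr mulrCA; congr (_ + _).
rewrite mulr_sumr /gauss [RHS](reindex_inj (mulfI l_Fp_neq0)) /=.
apply: eq_bigr => x _; rewrite (exprMn l (chin 1 x) (expchar z x)) (hn x) (expcharX pr zp x l).
rewrite (mulcharM (chi_mulchar gp sp n0)) mulrA; congr (_ * _ * _).
by rewrite /chi (qch_nat gp sp).
Qed.

Lemma qch_N1 : @qch nu (-1) = qsym nu (-1).
Proof.
have -> : -1 = p.-1%:R :> 'F_p.
  by apply/eqP; rewrite eq_sym -subr_eq0 opprK natr1 prednK ?prime_gt0 // pchar_Fp_0.
rewrite (qch_nat gp sp); apply: (qsym_cong gp); rewrite opprK natr1 prednK ?prime_gt0 //.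
by rewrite -[_%:R]/(p%:Z%:~R) (split_norm_nat nu) dvdg_normr // gprime_nz.
Qed.

Lemma gauss_recip1 : odd l -> (l %% 4 = 1)%N ->
  dvdg l%:R (qsym nu l%:R * (nu ^+ 3 * gconj nu) ^+ (l %/ 4) * (gnorm nu)%:~R - (gnorm nu)%:~R).
Proof.
move=> lo l1; have lE : l = ((l %/ 4) * 4).+1 by rewrite {1}(divn_eq l 4) l1 addn1.
apply: Amod_toC => //; first exact: prime_gt0.
have hn x : chin 1 x ^+ l = chin 1 x.
  have [->|x0] := eqVneq x 0.
    by rewrite (mulchar0 (chi_mulchar gp sp (n := 1) isT)) lE exprS mul0r.
  rewrite lE exprS mulnC exprM (_ : chin 1 x ^+ 4 = 1) ?expr1n ?mulr1 //.
  by rewrite -[RHS](chi4 gp sp x0) /chi expr1.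
have [e eE [_ e2]] := chi_N1 gp sp.
have := AmodMl (a := G 3 * toC e) _ (gauss_Frobenius hn isT).
rewrite rpredM ?gauss_Aint ?toC_Aint // => /(_ isT).
have -> : G 3 * toC e * G 1 = toC (gnorm nu)%:~R.
  rewrite mulrAC [G 3 * _]mulrC (gauss13 gp sp zp) eE mulrAC e2 mul1r.
  by rewrite rmorph_int /= -absz_gnorm.
have -> // : G 3 * toC e * (toC (qsym nu l%:R) ^+ 1 * G 1 ^+ l)
  = toC (qsym nu l%:R * (nu ^+ 3 * gconj nu) ^+ (l %/ 4) * (gnorm nu)%:~R).
have -> : G 1 ^+ l = G 1 * toC (nu ^+ 3 * gconj nu) ^+ (l %/ 4).
  by rewrite [in LHS]lE exprS mulnC exprM (quartic_gauss_pow4 gp sp zp).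
transitivity (toC (qsym nu l%:R) * toC (nu ^+ 3 * gconj nu) ^+ (l %/ 4) * (toC e * (G 1 * G 3))).
  by ring.
rewrite (gauss13 gp sp zp) eE [toC e * (toC e * _)]mulrA e2 mul1r -rmorphXn !rmorphM /= rmorph_int.
by rewrite -absz_gnorm.
Qed.

Lemma gauss_recip3 : (l %% 4 = 3)%N ->
  dvdg l%:R (qsym nu l%:R ^+ 3 * (nu ^+ 3 * gconj nu) ^+ (l.+1 %/ 4) - qsym nu (-1) * (gnorm nu)%:~R).
Proof.
move=> l3; have lE : l = (4 * (l %/ 4) + 3)%N by rewrite {1}(divn_eq l 4) l3 mulnC.
have lE' : l.+1 = (4 * (l.+1 %/ 4))%N by move: l3; clear; lia.
apply: Amod_toC => //; [by rewrite lE oddD oddM | exact: prime_gt0 |].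
have hn x : chin 1 x ^+ l = chin 3 x.
  have [->|x0] := eqVneq x 0.
    by rewrite !(mulchar0 (chi_mulchar gp sp _)) // lE addnS exprS mul0r.
  rewrite lE exprD exprM (_ : chin 1 x ^+ 4 = 1) ?expr1n ?mul1r //.
  by rewrite -[RHS](chi4 gp sp x0) /chi expr1.
have := AmodMl (a := G 1) _ (gauss_Frobenius hn isT).
rewrite gauss_Aint // => /(_ isT).
have -> : G 1 * G 3 = toC (qsym nu (-1) * (gnorm nu)%:~R).
  by rewrite (gauss13 gp sp zp) qch_N1 rmorphM rmorph_int /= -absz_gnorm.
have -> // : G 1 * (toC (qsym nu l%:R) ^+ 3 * G 1 ^+ l)
  = toC (qsym nu l%:R ^+ 3 * (nu ^+ 3 * gconj nu) ^+ (l.+1 %/ 4)).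
rewrite mulrCA -exprS lE' exprM (quartic_gauss_pow4 gp sp zp) -lE'.
by rewrite -!rmorphXn -rmorphM.
Qed.
End GaussFrobenius.

Lemma split_norm_mod4 nu : gprime nu -> (`|gnorm nu|%N %% 4 = 1)%N.
Proof. by move=> gp; have [-> _] := gprime_qexp gp; rewrite -addn1 mulnC modnMDl. Qed.

Lemma dvdg_dvdg (a b c : gint) : a != 0 -> b != 0 -> dvdg a b -> dvdg b c -> dvdg a c.
Proof. by move=> a0 b0 h /(dvdgP _ b0)[d ->]; apply: dvdgMr. Qed.

Lemma gprime_conorm mu nu : gprime mu -> coprimez (gnorm mu) (gnorm nu) -> ~~ dvdg mu nu.
Proof.
move=> gp cop; apply/negP => /(dvdg_norm (gprime_nz gp)) h.
have n1 : (1 < `|gnorm mu|)%N by rewrite -ltz_nat absz_gnorm gprime_norm_gt1.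
move: h cop; rewrite coprimezE dvdzE /coprime => /gcdn_idPl -> /eqP e.
by rewrite e in n1.
Qed.

(** Modulo an inert [l] the conjugate of [nu] is [nu ^ l], so the power of
[nu ^ 3 (conj nu)] given by the Gauss sum is [nu ^ ((l ^ 2 - 1) / 4)] times [nu ^ (l + 1)]. *)
Lemma recip_inert nu th : gprime nu -> split_prime nu -> gprime th -> inert_prime th ->
  qsym nu th = qsym th nu.
Proof.
move=> gp sp gt [l prl [l3 thE]]; have nz := gprime_nz gp; have tz := gprime_nz gt.
have lp : l != `|gnorm nu|%N.
  by apply/eqP => h; move: (split_norm_mod4 gp); rewrite -h l3.
have l0 : (l%:R : gint) != 0.
  by rewrite -gnorm_eq0 -[l%:R]/(l%:Z%:~R) gnorm_int; have := prime_gt0 prl; nia.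
have lpos : (0 < `|gnorm nu|)%N by apply: prime_gt0 sp.
have [z zp] := C_prim_root_exists lpos.
have tl : dvdg th l%:R by rewrite thE dvdg_natN ?prime_gt0 // -[l%:R]/(l%:Z%:~R) !gE dvdzz dvdz0.
have ndl : ~~ dvdg nu l%:R.
  by rewrite (split_dvdg_nat gp sp) dvdn_prime2 // eq_sym.
have nthnu : ~~ dvdg th nu.
  apply/negP => /(dvdg_norm tz); rewrite thE gnorm_int sqrrN -(absz_gnorm nu) dvdzE abszX /= => h.
  have : (l %| `|gnorm nu|)%N by apply: dvdn_trans h; rewrite dvdn_exp.
  by rewrite dvdn_prime2 // (negPf lp).
have h := dvdg_dvdg tz l0 tl (gauss_recip3 gp sp zp prl lp l3).
have hc : dvdg th (nu ^+ l - gconj nu) := dvdg_dvdg tz l0 tl (inert_Frobenius nu prl l3).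
have lE' : l.+1 = (4 * (l.+1 %/ 4))%N by move: l3; clear; lia.
set m := (l.+1 %/ 4)%N in h lE'.
have qE : qexp th = (l.-1 * m)%N.
  rewrite /qexp thE gnorm_int sqrrN abszX /=.
  have -> : (l ^ 2).-1 = (l.-1 * m * 4)%N.
    by rewrite -mulnA (mulnC m) -lE' -mulnn; have := prime_gt0 prl; clear; nia.
  by rewrite mulnK.
have h2 : dvdg th (nu ^+ l.+1 * (qsym nu l%:R ^+ 3 * nu ^+ qexp th - qsym nu (-1))).
  have -> : nu ^+ l.+1 * (qsym nu l%:R ^+ 3 * nu ^+ qexp th - qsym nu (-1))
    = qsym nu l%:R ^+ 3 * (nu ^+ 3 * nu ^+ l) ^+ m - qsym nu (-1) * (nu * nu ^+ l).
    rewrite mulrBr -!exprS -exprD -exprM mulrCA -exprD qE.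
    congr (_ * _ ^+ _ - _); last by ring.
    by rewrite lE'; have := prime_gt1 prl; move: lE'; clear; nia.
  rewrite (dvdg_addr tz (b := qsym nu l%:R ^+ 3 * (nu ^+ 3 * gconj nu) ^+ m - qsym nu (-1) * (gnorm nu)%:~R)) //.
  have refl (x : gint) : dvdg th (x - x) by rewrite subrr dvdg0.
  have -> (x y x' y' : gint) : x - y - (x' - y') = x - x' - (y - y') by ring.
  rewrite gnormE; apply: (dvdgB tz); apply: (dvdg_modM tz (refl _)).
    by apply: (dvdg_modX tz); apply: (dvdg_modM tz (refl _)).
  exact: (dvdg_modM tz (refl _)).
have {h2} h3 : dvdg th (qsym nu l%:R ^+ 3 * nu ^+ qexp th - qsym nu (-1)).
  by case/(gprime_Euclid gt)/orP: h2 => // /(gprimeX gt) h2; rewrite h2 in nthnu.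
have uN : qsym nu (-1) \in qunits.
  by apply: (qsym_unit gp); rewrite dvdgN // -qsym_eq0 // qsym1.
have ul := qsym_unit gp ndl; have ut := qsym_unit gt nthnu.
have e3 : qsym nu l%:R ^+ 3 * qsym th nu = qsym nu (-1).
  apply: (qvals_inj gt); rewrite ?qunits_vals //.
    by rewrite qunitsM // !exprS !qunitsM.
  apply: (dvdg_trans_mod tz _ h3); rewrite dvdg_sym //.
  by apply: (dvdg_modM tz); rewrite ?subrr ?dvdg0 // qsym_spec.
have -> : qsym nu th = qsym nu (-1) * qsym nu l%:R.
  by rewrite -qsymM // thE rmorphN mulN1r.
by rewrite -e3 mulrAC -exprSr qunitsX4 // mul1r.
Qed.

(** Modulo [th] the power [(nu ^ 3 (conj nu)) ^ ((l - 1) / 4)] given by the Gauss sum is the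
product of the inverse of the symbol of [nu] and the symbol of [conj nu]. *)
Lemma recip_split_int nu th : gprime nu -> split_prime nu -> gprime th -> split_prime th ->
  coprimez (gnorm nu) (gnorm th) ->
  qsym nu (gnorm th)%:~R = qsym th nu * qsym (gconj th) nu.
Proof.
move=> gp sp gt st cop; have nz := gprime_nz gp; have tz := gprime_nz gt.
set l := `|gnorm th|%N; have prl : prime l := st.
have lp : l != `|gnorm nu|%N.
  apply/eqP => h; move: cop; rewrite coprimezE -/l -h /coprime gcdnn.
  by have := prime_gt1 prl; lia.
have lpos : (0 < `|gnorm nu|)%N by apply: prime_gt0 sp.
have [z zp] := C_prim_root_exists lpos.
have l1 : (l %% 4 = 1)%N := split_norm_mod4 gt.
have lE : (l%:Z : int) = gnorm th := absz_gnorm th.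
have l0 : (l%:R : gint) != 0.
  by rewrite -gnorm_eq0 -[l%:R]/(l%:Z%:~R) gnorm_int; have := prime_gt0 prl; nia.
have tl : dvdg th l%:R by rewrite -[l%:R]/(l%:Z%:~R) lE dvdg_normr.
have lo : odd l by move: l1; clear; lia.
have h := dvdg_dvdg tz l0 tl (gauss_recip1 gp sp zp prl lp lo l1).
have n1 := gprime_conorm gp cop.
have cop' : coprimez (gnorm th) (gnorm nu) by rewrite coprimez_sym.
have n2 := gprime_conorm gt cop'.
have n3 : ~~ dvdg th (gconj nu) by apply: gprime_conorm gt _; rewrite gnorm_conj.
have n4 : ~~ dvdg nu l%:R by rewrite (split_dvdg_nat gp sp) dvdn_prime2 // eq_sym.
have qE : qexp th = (l %/ 4)%N by rewrite /qexp -/l; move: l1; clear; lia.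
set A := qsym nu l%:R * (nu ^+ 3 * gconj nu) ^+ (l %/ 4) in h.
have {}h : dvdg th ((gnorm nu)%:~R * (A - 1)) by rewrite mulrBr mulr1 mulrC.
have {h} h : dvdg th (A - 1).
  case/(gprime_Euclid gt)/orP: h => //; rewrite gnormE => /(gprime_Euclid gt).
  by rewrite (negPf n2) (negPf n3).
have e1 : qsym nu l%:R * (qsym th nu ^+ 3 * qsym th (gconj nu)) = 1.
  have u1 := qsym_unit gp n4; have u2 := qsym_unit gt n2; have u3 := qsym_unit gt n3.
  apply: (qvals_inj gt) => //.
    by rewrite qunits_vals // !exprS !qunitsM.
  apply: (dvdg_trans_mod tz _ h); rewrite dvdg_sym // /A -qE.
  apply: (dvdg_modM tz); first by rewrite subrr dvdg0.
  rewrite exprMn -exprM mulnC exprM; apply: (dvdg_modM tz); last exact: qsym_spec.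
  by apply: (dvdg_modX tz); apply: qsym_spec.
have u2 := qsym_unit gt n2; have u3 := qsym_unit gt n3.
have -> : qsym (gconj th) nu = gconj (qsym th (gconj nu)) by rewrite -qsym_conj // gconjK.
rewrite -lE -[qsym nu _]mulr1 -{2}(qunits_mulC u3) -[_%:~R]/(l%:R).
transitivity ((qsym nu l%:R * (qsym th nu ^+ 3 * qsym th (gconj nu))) * qsym th nu * gconj (qsym th (gconj nu))).
  rewrite !mulrA; congr (_ * _).
  have : qsym nu l%:R * qsym th nu ^+ 4 * qsym th (gconj nu) = qsym nu l%:R * qsym th (gconj nu).
    by rewrite (qunitsX4 u2) mulr1.
  by move=> <-; ring.
by rewrite e1 mul1r.
Qed.

(** [(-1) ^ k], for an integer exponent and with a Gaussian value. *)
Definition zsign (k : int) : gint := if (2 %| k)%Z then 1 else -1.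

Lemma zsignD a b : zsign (a + b) = zsign a * zsign b.
Proof. by rewrite /zsign; case: ifP; case: ifP; case: ifP => *; rewrite ?mulrNN ?mulr1 ?mul1r //; lia. Qed.

Lemma zsign_eq a b : (2 %| a - b)%Z -> zsign a = zsign b.
Proof. by rewrite /zsign; case: ifP; case: ifP => // *; lia. Qed.

Lemma zsign_even a : (2 %| a)%Z -> zsign a = 1.
Proof. by rewrite /zsign => ->. Qed.


Lemma zsign_sq a : zsign a * zsign a = 1.
Proof. by rewrite -zsignD zsign_even //; lia. Qed.

Lemma zsign_unit a : zsign a \in qunits.
Proof. by rewrite /zsign; case: ifP. Qed.


Lemma gI_double (k : nat) : gI ^+ (2 * k) = zsign k%:Z.
Proof.
rewrite exprM (_ : gI ^+ 2 = -1) // /zsign -signr_odd.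
by have [o|o] := boolP (odd k); rewrite ?expr1 ?expr0; case: ifP => //; lia.
Qed.


(** A primary [u + v i] has [u] odd, hence a norm congruent to [1 + v ^ 2] modulo 8. *)
Lemma qsym_N1 nu : gprime nu -> qsym nu (-1) = zsign (gim nu %/ 2)%Z.
Proof.
move=> gp; rewrite -gI2 qsymM // qsym_I // -expr2 -exprM mulnC gI_double.
have [pn _] := gp; have [qE _] := gprime_qexp gp; apply: zsign_eq.
have {qE} : gnorm nu = (4 * qexp nu).+1%:Z by rewrite -absz_gnorm qE.
move: (qexp nu) => q; case: (nu) pn => u v; rewrite /primary /gnorm /=.
move=> /andP[/dvdzP[e ->] /dvdzP[f hf]].
have -> : u = 4 * f + 1 - 2 * e by lia.
rewrite mulzK // => h.
have -> : (q%:Z) = 4 * f ^+ 2 + 2 * e ^+ 2 + 2 * f - e - 4 * f * e by lia.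
apply/dvdzP; exists (2 * f ^+ 2 + e ^+ 2 + f - e - 2 * f * e); ring.
Qed.

(** ** Rational moduli *)

(** The part of the theory that rational moduli enjoy: it holds for an inert prime and for
a pair of conjugate split primes, and it is stable under products. *)
Record ratlist (n : int) (ls : seq gint) : Prop := RatList {
  rat_gprimes : gprimes ls;
  rat_gprod : gprod ls = n%:~R;
  rat_recip : forall nu, gprime nu -> split_prime nu -> coprimez (gnorm nu) n ->
    qsym nu n%:~R = qsyms ls nu;
  rat_conj : forall a : gint, qsyms ls (gconj a) = gconj (qsyms ls a);
  rat_int : forall m : int, coprimez m n -> qsyms ls m%:~R = 1 }.

Lemma ratlist_nil : ratlist 1 [::].
Proof.
split=> //; first by rewrite /gprod big_nil.
- by move=> nu gp _ _; rewrite qsym1 // /qsyms big_nil.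
- by move=> a; rewrite /qsyms !big_nil rmorph1.
- by move=> m _; rewrite /qsyms big_nil.
Qed.

Lemma ratlist_cat m n ms ns : ratlist m ms -> ratlist n ns -> ratlist (m * n) (ms ++ ns).
Proof.
move=> hm hn; split.
- by apply/gprimes_cat; split; [apply: rat_gprimes hm | apply: rat_gprimes hn].
- by rewrite gprod_cat (rat_gprod hm) (rat_gprod hn) rmorphM.
- move=> nu gp sp; rewrite coprimezMr => /andP[c1 c2].
  by rewrite rmorphM qsymM // (rat_recip hm) // (rat_recip hn) // qsyms_cat.
- by move=> a; rewrite !qsyms_cat rmorphM (rat_conj hm) (rat_conj hn).
- move=> k; rewrite coprimezMr => /andP[c1 c2].
  by rewrite qsyms_cat (rat_int hm) // (rat_int hn) // mulr1.
Qed.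

Lemma inert_gprime l : prime l -> (l %% 4 = 3)%N -> gprime (- l%:Z)%:~R.
Proof. by move=> pr l3; split; [rewrite /primary !gE; lia | right; exists l]. Qed.

Lemma ratlist_inert l : prime l -> (l %% 4 = 3)%N -> ratlist (- l%:Z) [:: (- l%:Z)%:~R].
Proof.
move=> pr l3; have gp := inert_gprime pr l3.
have ip : inert_prime (- l%:Z)%:~R by exists l.
split; [exact: gprimes1 | by rewrite /gprod big_seq1 | | |].
- by move=> nu gn sn _; rewrite qsyms_seq1; apply: recip_inert.
- by move=> a; rewrite !qsyms_seq1 -qsym_conj // gconj_int.
- move=> m cop; rewrite qsyms_seq1 qsym_inert_int //; apply: gprime_conorm => //.
  by rewrite !gnorm_int !coprimez_pexpl // coprimez_pexpr // coprimez_sym.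
Qed.

Lemma ratlist_split th : gprime th -> split_prime th -> ratlist (gnorm th) [:: th; gconj th].
Proof.
move=> gt st; have gt' := gprime_conj gt.
have LE (a : gint) : qsyms [:: th; gconj th] a = qsym th a * qsym (gconj th) a.
  by rewrite qsyms_cons qsyms_seq1.
split.
- by apply/gprimes_cons; split=> //; apply: gprimes1.
- by rewrite /gprod big_cons big_seq1 gnormE.
- by move=> nu gn sn cop; rewrite LE recip_split_int.
- by move=> a; rewrite !LE rmorphM /= -(qsym_conj a gt) -(qsym_conj a gt') gconjK mulrC.
- move=> m cop; rewrite LE -{2}(gconj_int m) qsym_conj // qunits_mulC //; apply: qsym_unit => //.
  by apply: gprime_conorm => //; rewrite gnorm_int coprimez_pexpr // coprimez_sym.
Qed.

(** Rational primes that are 3 modulo 4 enter with a negative sign, so that the number stays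
1 modulo 4. *)
Lemma ratlist_exists (n : int) : (4 %| n - 1)%Z -> exists ls, ratlist n ls.
Proof.
have [k] := ubnP `|n|%N; elim: k n => // k IH n lt_n n4.
have [n1|n1] := leqP `|n|%N 1.
  have n1' : n = 1 by move: n1 n4; clear; lia.
  by exists [::]; rewrite n1'; exact: ratlist_nil.
pose l := pdiv `|n|%N; have pr : prime l by apply: pdiv_prime.
have dl : (l%:Z %| n)%Z by rewrite dvdzE; apply: pdiv_dvd.
have/dvdzP[m nE] := dl.
have l2 := prime_gt1 pr.
have lt_m : (`|m| < k)%N.
  have m0 : (0 < `|m|)%N by rewrite absz_gt0; apply: contraTneq n1 => m0; rewrite nE m0 mul0r.
  move: lt_n; rewrite nE abszM ltnS /=; apply: leq_trans.
  by rewrite ltn_Pmulr.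
have [l3|l1] : (l %% 4 = 3)%N \/ (l %% 4 = 1)%N.
  have lo : odd l.
    apply/negPn/negP => le; have : (2 %| n)%Z by apply: dvdz_trans dl; rewrite dvdzE /=; lia.
    by move: n4; clear; lia.
  by move: lo; clear; lia.
- have [||ls hl] := IH (- m); first by rewrite abszN.
    move: n4; rewrite nE => /dvdzP[q hq]; have [s ls] : exists s : int, l%:Z = 4 * s + 3.
      by exists (l %/ 4)%N%:Z; move: l3; clear; lia.
    by apply/dvdzP; exists (q - m * (s + 1)); move: hq; rewrite ls; clear; lia.
  exists ((- l%:Z)%:~R :: ls); have -> : n = - l%:Z * - m by rewrite nE; ring.
  exact: (ratlist_cat (ratlist_inert pr l3) hl).
have [th [gt st Nth]] := split_exists pr l1.
have [|ls hl] := IH m lt_m.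
  move: n4; rewrite nE => /dvdzP[q hq]; have [s ls] : exists s : int, l%:Z = 4 * s + 1.
    by exists (l %/ 4)%N%:Z; move: l1; clear; lia.
  by apply/dvdzP; exists (q - m * s); move: hq; rewrite ls; clear; lia.
exists ([:: th; gconj th] ++ ls); have -> : n = gnorm th * m by rewrite nE Nth mulrC.
exact: (ratlist_cat (ratlist_split gt st) hl).
Qed.

(** The exponent is [(n ^ 2 - 1) / 4], that is twice [(n - 1) / 4] times the odd
number [(n + 1) / 2]. *)
Lemma ratlist_I n ls : (4 %| n - 1)%Z -> ratlist n ls -> qsyms ls gI = zsign ((n - 1) %/ 4)%Z.
Proof.
move=> /dvdzP[k kE] hl; rewrite kE mulzK // qsyms_I; last exact: rat_gprimes hl.
rewrite (rat_gprod hl) gnorm_int (_ : n = 4 * k + 1); last by lia.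
have N : (4 * k + 1) ^+ 2 = 8 * (k * (2 * k + 1)) + 1 by ring.
have [m mE] : exists m : nat, k * (2 * k + 1) = m%:Z.
  by exists (absz (k * (2 * k + 1))%R); rewrite gez0_abs //; clear; nia.
rewrite N mE (_ : (absz (8 * m%:Z + 1)%R).-1 = 2 * m * 4)%N; last by clear; lia.
rewrite mulnK // gI_double -mE; apply: zsign_eq.
by apply/dvdzP; exists (k ^+ 2); ring.
Qed.

Lemma split_coprime nu : split_prime nu -> coprimez (gre nu) (gim nu).
Proof.
move=> pr; rewrite coprimezE /coprime; set g := gcdn _ _.
have g1 : (g%:Z %| gre nu)%Z by rewrite dvdzE dvdn_gcdl.
have g2 : (g%:Z %| gim nu)%Z by rewrite dvdzE dvdn_gcdr.
have gg : (g * g %| `|gnorm nu|)%N.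
  have : (g%:Z * g%:Z %| gnorm nu)%Z by rewrite /gnorm !expr2 rpredD // dvdz_mul.
  by rewrite dvdzE.
have/primeP[p1 /(_ g (dvdn_trans (dvdn_mulr g (dvdnn g)) gg))/orP[//|/eqP gE]] := pr.
move: gg p1; rewrite -gE => /dvdn_leq; have := prime_gt0 pr; rewrite -gE => g0 /(_ g0).
by rewrite -{3}(muln1 g) leq_pmul2l // => h _; rewrite eqn_leq h.
Qed.

Lemma coprime_norm_re (a : gint) : coprimez (gre a) (gim a) -> coprimez (gnorm a) (gre a).
Proof.
move=> h; rewrite coprimez_sym /coprimez /gnorm expr2 gcdzMDl.
by have := coprimez_pexpr (gre a) (gim a) (isT : (0 < 2)%N); rewrite h.
Qed.

Lemma split_ncoprime nu (n : int) : gprime nu -> split_prime nu ->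
  coprimez (gnorm nu) n = ~~ dvdg nu n%:~R.
Proof. by move=> gp sp; rewrite split_dvdg_int // coprimezE dvdzE prime_coprime. Qed.

Lemma qsyms_unit_coprime ps (a : gint) : gprimes ps -> coprimez (gnorm (gprod ps)) (gnorm a) ->
  qsyms ps a \in qunits.
Proof.
move=> gps cop; apply: (qsyms_unit gps) => nu hn; apply: gprime_conorm; first exact: gps.
apply: coprimez_dvdl cop; rewrite /gprod (big_rem nu) //= gnormM.
by rewrite abszM dvdn_mulr.
Qed.

Definition primaryz (n : int) : int := if (4 %| n - 1)%Z then n else - n.

Lemma primaryz4 n : ~~ (2 %| n)%Z -> (4 %| primaryz n - 1)%Z.
Proof. by rewrite /primaryz; case: ifP => // *; lia. Qed.

(** For odd [n > 0] this is the value of the Jacobi symbol of [-2] modulo [n]. *)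
Definition jacobi_m2 (n : int) : gint :=
  if (4 %| n - 1)%Z then zsign ((n - 1) %/ 4)%Z else zsign ((3 - n) %/ 4)%Z.

Lemma qsym_primaryz nu (n : int) : gprime nu ->
  qsym nu n%:~R = qsym nu (primaryz n)%:~R * (if (4 %| n - 1)%Z then 1 else qsym nu (-1)).
Proof.
move=> gp; rewrite /primaryz; case: ifP => _; first by rewrite mulr1.
by rewrite -qsymM // rmorphN mulrN1 opprK.
Qed.

Lemma coprimez_primaryz m n : coprimez m (primaryz n) = coprimez m n.
Proof. by rewrite /primaryz; case: ifP; rewrite // coprimezN. Qed.

Lemma dvdg_primaryz (n : int) (a : gint) : n != 0 ->
  dvdg (primaryz n)%:~R a = dvdg n%:~R a.
Proof.
move=> n0; rewrite /primaryz; case: ifP => // _.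
by rewrite !dvdg_int ?oppr_eq0 // !dvdzE abszN.
Qed.

Lemma ratlist_dvd n ls (a b : gint) : ratlist n ls -> dvdg n%:~R (a - b) -> qsyms ls a = qsyms ls b.
Proof. by move=> hl h; apply: (qsyms_cong (rat_gprimes hl)); rewrite (rat_gprod hl). Qed.

Lemma primary_param (a : gint) : primary a ->
  exists e f : int, gim a = 2 * e /\ gre a = 4 * f + 1 - 2 * e.
Proof.
move=> /andP[/dvdzP[e h1] /dvdzP[f h2]]; exists e, f; split; first by rewrite h1 mulrC.
by move: h1 h2; clear; lia.
Qed.

Lemma primary_re_odd (a : gint) : primary a -> ~~ (2 %| gre a)%Z.
Proof. by case: a => u v; rewrite /primary /=; lia. Qed.

Lemma odd_neq0 (n : int) : ~~ (2 %| n)%Z -> n != 0.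
Proof. by apply: contraNneq => ->. Qed.

Lemma gint_subr_im (a : gint) : a - (gim a)%:~R * gI = (gre a)%:~R.
Proof. by rewrite {1}(gintE a) addrK. Qed.

(** Modulo its real part, [nu] is [i] times a rational integer. *)
Lemma qsym_re nu : gprime nu -> split_prime nu -> qsym nu (gre nu)%:~R = jacobi_m2 (gre nu).
Proof.
move=> gp sp; have [pn _] := gp; have co := primary_re_odd pn.
have [ls hl] := ratlist_exists (primaryz4 co).
have cop := coprime_norm_re (split_coprime sp).
rewrite qsym_primaryz // (rat_recip hl) ?coprimez_primaryz //.
have -> : qsyms ls nu = qsyms ls ((gim nu)%:~R * gI).
  apply: (ratlist_dvd hl); rewrite dvdg_primaryz ?odd_neq0 //.
  by rewrite gint_subr_im dvdg_refl // -gnorm_eq0 gnorm_int sqrf_eq0 odd_neq0.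
rewrite (qsymsM (rat_gprimes hl)) (rat_int hl); last first.
  by rewrite coprimez_primaryz coprimez_sym split_coprime.
rewrite mul1r (ratlist_I (primaryz4 co) hl) qsym_N1 // /jacobi_m2 /primaryz.
have [e [f [-> ->]]] := primary_param pn; rewrite mulKz //.
case: ifP => h; first by rewrite mulr1.
by rewrite -zsignD; apply: zsign_eq; move: h; clear; lia.
Qed.

(** The case analysis modulo 8 behind the reciprocity sign: [4 f + 1 - 2 e] and [2 e]
are the coordinates of a primary number. *)
Lemma sign_identity (e f e' f' n : int) :
  n = (4 * f + 1 - 2 * e) * (4 * f' + 1 - 2 * e') + 2 * e * (2 * e') ->
  jacobi_m2 (4 * f + 1 - 2 * e) * zsign ((primaryz n - 1) %/ 4)%Z * jacobi_m2 (4 * f' + 1 - 2 * e') *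
    (if (4 %| n - 1)%Z then 1 else zsign e') * (if (4 %| n - 1)%Z then 1 else zsign e)
  = zsign (e * e').
Proof.
have r1 (m : int) : (4 %| 4 * m + 1 - 1)%Z by clear; lia.
have r3 (m : int) : (4 %| 4 * m - 1 - 1)%Z = false by clear; lia.
have q1 (m : int) : ((4 * m + 1 - 1) %/ 4)%Z = m by clear; lia.
have q3 (m : int) : ((3 - (4 * m - 1)) %/ 4)%Z = 1 - m by clear; lia.
have q3' (m : int) : ((- (4 * m - 1) - 1) %/ 4)%Z = - m by clear; lia.
have [g [eg|eg]] : exists g, e = 2 * g \/ e = 2 * g + 1 by exists (e %/ 2)%Z; clear; lia.
all: have [g' [eg'|eg']] : exists g, e' = 2 * g \/ e' = 2 * g + 1 by exists (e' %/ 2)%Z; clear; lia.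
all: rewrite {e}eg {e'}eg'.
- have -> : 4 * f + 1 - 2 * (2 * g) = 4 * (f - g) + 1 by ring.
  have -> : 4 * f' + 1 - 2 * (2 * g') = 4 * (f' - g') + 1 by ring.
  move: (f - g) (f' - g') => u v nE.
  have {nE} -> : n = 4 * (4 * (u * v + g * g') + u + v) + 1 by rewrite nE; ring.
  rewrite /jacobi_m2 /primaryz !r1 !q1 !mulr1 -!zsignD; apply: zsign_eq.
  by apply/dvdzP; exists (u + v + 2 * u * v); ring.
- have -> : 4 * f + 1 - 2 * (2 * g) = 4 * (f - g) + 1 by ring.
  have -> : 4 * f' + 1 - 2 * (2 * g' + 1) = 4 * (f' - g') - 1 by ring.
  move: (f - g) (f' - g') => u v nE.
  have {nE} -> : n = 4 * (4 * (u * v) - u + v + 2 * g * (2 * g' + 1)) - 1 by rewrite nE; ring.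
  rewrite /jacobi_m2 /primaryz !r1 !r3 !q1 !q3 !q3' -!zsignD; apply: zsign_eq.
  by apply/dvdzP; exists (u - v - 2 * u * v + 1 - 4 * g * g' + g' - g); ring.
- have -> : 4 * f + 1 - 2 * (2 * g + 1) = 4 * (f - g) - 1 by ring.
  have -> : 4 * f' + 1 - 2 * (2 * g') = 4 * (f' - g') + 1 by ring.
  move: (f - g) (f' - g') => u v nE.
  have {nE} -> : n = 4 * (4 * (u * v) + u - v + 2 * g' * (2 * g + 1)) - 1 by rewrite nE; ring.
  rewrite /jacobi_m2 /primaryz !r1 !r3 !q1 !q3 !q3' -!zsignD; apply: zsign_eq.
  by apply/dvdzP; exists (v - u - 2 * u * v + 1 - 4 * g * g' + g - g'); ring.
have -> : 4 * f + 1 - 2 * (2 * g + 1) = 4 * (f - g) - 1 by ring.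
have -> : 4 * f' + 1 - 2 * (2 * g' + 1) = 4 * (f' - g') - 1 by ring.
move: (f - g) (f' - g') => u v nE.
have {nE} -> : n = 4 * (4 * (u * v) - u - v + (2 * g + 1) * (2 * g' + 1)) + 1 by rewrite nE; ring.
rewrite /jacobi_m2 /primaryz !r1 !r3 !q1 !q3 !mulr1 -!zsignD; apply: zsign_eq.
by apply/dvdzP; exists (1 - u - v + 2 * u * v); ring.
Qed.

(** The real part [n] of [nu * gconj th] is [gre nu * th] modulo [nu] and [gre th * nu]
modulo [th], and [nu * gconj th] is [i] times a rational integer modulo [n]. Rational
reciprocity therefore compares both symbols, up to signs that only depend on [n] and
the two real parts modulo 8. *)
Lemma recip_split_split nu th : gprime nu -> split_prime nu -> gprime th -> split_prime th ->
  coprimez (gnorm nu) (gnorm th) ->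
  qsym nu th = qsym th nu * zsign ((gim nu %/ 2)%Z * (gim th %/ 2)%Z).
Proof.
move=> gp sp gt st cop.
have cop' : coprimez (gnorm th) (gnorm nu) by rewrite coprimez_sym.
have [[pn _] [pt _]] := (gp, gt); have nz := gprime_nz gp; have tz := gprime_nz gt.
set w := nu * gconj th; have pw : primary w by rewrite primaryM ?primary_conj.
set n := gre w; set k := gim w.
have no : ~~ (2 %| n)%Z := primary_re_odd pw.
have h1 : dvdg nu (n%:~R - (gre nu)%:~R * th).
  have -> : n%:~R - (gre nu)%:~R * th = nu * (- gI * (gim th)%:~R).
    by apply: gint_eq; rewrite /n /w !gE /=; ring.
  by rewrite dvdgMr ?dvdg_refl.
have h2 : dvdg th (n%:~R - (gre th)%:~R * nu).
  have -> : n%:~R - (gre th)%:~R * nu = th * (- gI * (gim nu)%:~R).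
    by apply: gint_eq; rewrite /n /w !gE /=; ring.
  by rewrite dvdgMr ?dvdg_refl.
have c1 : coprimez (gnorm nu) n.
  rewrite split_ncoprime // (dvdg_addr nz h1) gprime_EuclidE // negb_or -split_ncoprime //.
  by rewrite (coprime_norm_re (split_coprime sp)) gprime_conorm.
have c2 : coprimez (gnorm th) n.
  rewrite split_ncoprime // (dvdg_addr tz h2) gprime_EuclidE // negb_or -split_ncoprime //.
  by rewrite (coprime_norm_re (split_coprime st)) gprime_conorm.
have c3 : coprimez k n.
  have : coprimez n (gnorm w) by rewrite gnormM gnorm_conj coprimezMr ![coprimez n _]coprimez_sym c1.
  by rewrite /coprimez /gnorm expr2 gcdzMDl -/(coprimez _ _) coprimez_pexpr // coprimez_sym.
have [ls hl] := ratlist_exists (primaryz4 no).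
have gls := rat_gprimes hl.
have u (a : gint) : coprimez (gnorm a) n -> qsyms ls a \in qunits.
  move=> h; apply: (qsyms_unit_coprime gls).
  by rewrite (rat_gprod hl) gnorm_int coprimez_pexpl // coprimez_sym coprimez_primaryz.
have S : qsyms ls nu * gconj (qsyms ls th) = zsign ((primaryz n - 1) %/ 4)%Z.
  rewrite -(rat_conj hl) -(qsymsM gls) -(ratlist_I (primaryz4 no) hl).
  transitivity (qsyms ls (k%:~R * gI)).
    apply: (ratlist_dvd hl); rewrite dvdg_primaryz ?odd_neq0 // -/w.
    by rewrite gint_subr_im dvdg_refl // -gnorm_eq0 gnorm_int sqrf_eq0 odd_neq0.
  by rewrite (qsymsM gls) (rat_int hl) ?mul1r // coprimez_primaryz.
have e1 : qsym nu n%:~R = jacobi_m2 (gre nu) * qsym nu th.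
  by rewrite (qsym_cong gp h1) qsymM // qsym_re.
have e2 : qsym th n%:~R = jacobi_m2 (gre th) * qsym th nu.
  by rewrite (qsym_cong gt h2) qsymM // qsym_re.
move: e1 e2; rewrite (qsym_primaryz n gp) (qsym_primaryz n gt) !(rat_recip hl) ?coprimez_primaryz // !qsym_N1 //.
move=> e1 e2.
have zhu m : jacobi_m2 m \in qunits by rewrite /jacobi_m2; case: ifP => _; apply: zsign_unit.
have zh2 m : jacobi_m2 m * jacobi_m2 m = 1 by rewrite /jacobi_m2; case: ifP => _; apply: zsign_sq.
have ut : qsym th nu \in qunits by apply: qsym_unit; rewrite // gprime_conorm.
have -> : qsym nu th = jacobi_m2 (gre nu) * (jacobi_m2 (gre nu) * qsym nu th) by rewrite mulrA zh2 mul1r.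
rewrite -e1.
have Snu : qsyms ls nu = zsign ((primaryz n - 1) %/ 4)%Z * qsyms ls th.
  by rewrite -S -mulrA [gconj _ * _]mulrC qunits_mulC ?mulr1 // u.
have Lth : qsyms ls th = jacobi_m2 (gre th) * qsym th nu *
    (if (4 %| n - 1)%Z then 1 else zsign (gim th %/ 2)%Z).
  by rewrite -e2 -mulrA; case: ifP; rewrite ?zsign_sq ?mulr1.
rewrite Snu Lth.
set s := zsign _; set A := jacobi_m2 _; set B := jacobi_m2 _; set C := if _ then _ else _; set D := if _ then _ else _.
have -> : A * (s * (B * qsym th nu * C) * D) = qsym th nu * (A * s * B * C * D) by ring.
congr (_ * _); rewrite {}/A {}/s {}/B {}/C {}/D.
have nE : n = gre nu * gre th + gim nu * gim th by rewrite /n /w greM /= mulrN opprK.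
move: nE; have [e [f [-> ->]]] := primary_param pn; have [e' [f' [-> ->]]] := primary_param pt.
rewrite !mulKz //; move: {S Snu Lth e1 e2 h1 h2 c1 c2 c3 u hl no} n => n.
exact: sign_identity.
Qed.


(** Half the imaginary part measures the norm modulo 8: the sign is trivial as soon as one of
the norms is congruent to 1 modulo 8. *)
Lemma prime_reciprocity nu th : gprime nu -> gprime th -> coprimez (gnorm nu) (gnorm th) ->
  qsym nu th = qsym th nu * zsign ((gim nu %/ 2)%Z * (gim th %/ 2)%Z).
Proof.
move=> gp gt cop.
have [_ [sp|ip]] := gp; have [_ [st|it]] := gt; first exact: recip_split_split.
- rewrite recip_inert //; case: it => l _ [_ ->].
  by rewrite gim_int div0z mulr0 mulr1.
- rewrite -recip_inert //; case: ip => l _ [_ ->].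
  by rewrite gim_int div0z mul0r mulr1.
have nu1 := gprime_conorm gp cop.
have th1 : ~~ dvdg th nu by apply: gprime_conorm => //; rewrite coprimez_sym.
have [l _ [_ nE]] := ip; have [m _ [_ tE]] := it.
have -> : qsym nu th = 1 by rewrite tE qsym_inert_int // -tE.
have -> : qsym th nu = 1 by rewrite nE qsym_inert_int // -nE.
by rewrite nE gim_int div0z mul0r mulr1.
Qed.

Lemma half_imM (a b : gint) : primary a -> primary b ->
  (2 %| (gim (a * b) %/ 2)%Z - ((gim a %/ 2)%Z + (gim b %/ 2)%Z))%Z.
Proof.
move=> /primary_param[e [f [he hf]]] /primary_param[e' [f' [he' hf']]].
rewrite gimM he hf he' hf'.
have -> : (4 * f + 1 - 2 * e) * (2 * e') + 2 * e * (4 * f' + 1 - 2 * e')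
   = 2 * (e + e' + 2 * (2 * f * e' + 2 * e * f' - 2 * e * e')) by ring.
by rewrite !mulKz // addrC addKr dvdz_mulr.
Qed.

Lemma half_im_gprod ps (c : int) : gprimes ps ->
  \prod_(nu <- ps) zsign ((gim nu %/ 2)%Z * c) = zsign ((gim (gprod ps) %/ 2)%Z * c).
Proof.
elim: ps => [|nu ps IH]; first by rewrite /gprod !big_nil gim1 div0z mul0r.
move=> /gprimes_cons[gp gps]; have [pn _] := gp.
rewrite big_cons IH // -zsignD /gprod big_cons -/(gprod ps) -mulrDl.
apply: zsign_eq; rewrite -mulrBl dvdz_mulr // -rpredN opprB.
exact: half_imM (gprod_primary gps).
Qed.

Lemma gnorm_gprod ps nu : nu \in ps -> (gnorm nu %| gnorm (gprod ps))%Z.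
Proof. by move=> h; rewrite /gprod (big_rem nu) //= gnormM dvdz_mulr. Qed.

Lemma qsym_qsyms_reciprocity nu qs : gprime nu -> gprimes qs ->
  coprimez (gnorm nu) (gnorm (gprod qs)) -> (4 %| gim (gprod qs))%Z ->
  qsym nu (gprod qs) = qsyms qs nu.
Proof.
move=> gp gqs cop h4.
have -> : qsym nu (gprod qs) = \prod_(th <- qs) qsym nu th.
  elim: qs {gqs cop h4} => [|th qs IH]; first by rewrite /gprod !big_nil qsym1.
  by rewrite /gprod !big_cons qsymM // IH.
rewrite big_seq (eq_bigr (fun th => qsym th nu * zsign ((gim th %/ 2)%Z * (gim nu %/ 2)%Z))).
  rewrite -big_seq big_split /= half_im_gprod // zsign_even ?mulr1 //.
  by apply: dvdz_mulr; move: h4; clear; lia.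
move=> th ht; rewrite [(gim th %/ 2)%Z * _]mulrC; apply: prime_reciprocity => //.
  exact: gqs.
by apply: coprimez_dvdr cop; apply: gnorm_gprod.
Qed.

(** The condition on the imaginary part says that the norm of [gprod qs] is 1 modulo 8, so
that the signs in [prime_reciprocity] cancel out. *)
Lemma quartic_reciprocity ps qs : gprimes ps -> gprimes qs ->
  coprimez (gnorm (gprod ps)) (gnorm (gprod qs)) -> (4 %| gim (gprod qs))%Z ->
  qsyms ps (gprod qs) = qsyms qs (gprod ps).
Proof.
move=> gps gqs cop h4.
transitivity (\prod_(nu <- ps) qsyms qs nu).
  rewrite /qsyms !big_seq; apply: eq_bigr => nu hn; apply: qsym_qsyms_reciprocity => //.
    exact: gps.
  by apply: coprimez_dvdl cop; apply: gnorm_gprod.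
elim: ps {gps cop} => [|nu ps IH]; first by rewrite /gprod !big_nil qsyms1.
by rewrite /gprod !big_cons qsymsM // IH.
Qed.

(** * Supplementary laws *)

Lemma coprimezDMl m n k : coprimez m (k * m + n) = coprimez m n.
Proof. by rewrite /coprimez gcdzMDl. Qed.


Lemma coprimez2 (n : int) : ~~ (2 %| n)%Z -> coprimez 2 n.
Proof. by rewrite coprimezE dvdzE prime_coprime. Qed.

Section OneModEight.
Variable ps : seq gint.
Hypothesis gps : gprimes ps.

Lemma qsyms_I8 (m : int) : gnorm (gprod ps) = 8 * m + 1 -> qsyms ps gI = zsign m.
Proof.
move=> hm; have m0 : 0 <= m by have := gnorm_ge0 (gprod ps); rewrite hm; clear; lia.
rewrite qsyms_I // hm -(gez0_abs m0); move: `|m|%N => {hm m0} k.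
rewrite (_ : (absz (8 * k%:Z + 1)%R).-1 = 2 * k * 4)%N; last by clear; lia.
by rewrite mulnK // gI_double.
Qed.

Hypothesis N8 : (8 %| gnorm (gprod ps) - 1)%Z.

Lemma qsyms_N1 : qsyms ps (-1) = 1.
Proof.
have/dvdzP[m hm] := N8.
rewrite -gI2 qsymsM // (@qsyms_I8 m) ?zsign_sq //; move: hm; clear; lia.
Qed.

Lemma qsyms_opp (a : gint) : qsyms ps (- a) = qsyms ps a.
Proof. by rewrite -mulN1r qsymsM // qsyms_N1 mul1r. Qed.

(** The sign of [n] is immaterial, since the symbol of -1 is trivial for a norm that is 1
modulo 8. *)
Lemma qsyms_rational (n : int) ls : ratlist (primaryz n) ls -> coprimez (gnorm (gprod ps)) n ->
  qsyms ps n%:~R = qsyms ls (gprod ps).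
Proof.
move=> hl cop.
have -> : qsyms ps n%:~R = qsyms ps (primaryz n)%:~R.
  by rewrite /primaryz; case: ifP => // _; rewrite rmorphN /= qsyms_opp.
rewrite -(rat_gprod hl); apply: quartic_reciprocity => //.
- exact: rat_gprimes hl.
- by rewrite (rat_gprod hl) gnorm_int coprimez_pexpr // coprimez_primaryz.
by rewrite (rat_gprod hl) gim_int.
Qed.
End OneModEight.

Lemma one_mod8 (u v : int) : ~~ (2 %| u)%Z -> (4 %| v)%Z -> (8 %| gnorm (GInt u v) - 1)%Z.
Proof.
move=> uo /dvdzP[j ->]; have [k ->] : exists k, u = 2 * k + 1.
  by exists (u %/ 2)%Z; move: uo; clear; lia.
have [t tE] : exists t, k * (k + 1) = 2 * t.
  have [h|h] : (2 %| k)%Z \/ (2 %| k + 1)%Z by clear; lia.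
    by have/dvdzP[s ->] := h; exists (s * (s * 2 + 1)); ring.
  by have/dvdzP[s hs] := h; exists (k * s); rewrite hs; ring.
rewrite /gnorm /=; apply/dvdzP; exists (t + 2 * j ^+ 2).
have -> : (2 * k + 1) ^+ 2 + (j * 4) ^+ 2 - 1 = 4 * (k * (k + 1)) + 16 * j ^+ 2 by ring.
by rewrite tE; ring.
Qed.

(** With [kappa = u + v i], one has [u + v = u (1 + i)] modulo [kappa] and
[kappa = u (1 - i)] modulo [u + v], so the symbol of [1 + i] reduces to rational moduli. *)
Lemma qsyms_2 ps (u v : int) : gprimes ps -> gprod ps = GInt u v -> (4 %| u - 1)%Z ->
  (4 %| v)%Z -> coprimez u v -> qsyms ps 2%:~R = zsign (v %/ 4)%Z.
Proof.
move=> gps psE u4 v4 cuv.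
have uo : ~~ (2 %| u)%Z by move: u4; clear; lia.
have no : ~~ (2 %| u + v)%Z by move: u4 v4; clear; lia.
have n4 : (4 %| u + v - 1)%Z by move: u4 v4; clear; lia.
have N8 : (8 %| gnorm (gprod ps) - 1)%Z by rewrite psE one_mod8.
have prn n : (4 %| n - 1)%Z -> primaryz n = n by rewrite /primaryz => ->.
have cNu : coprimez (gnorm (gprod ps)) u.
  by rewrite psE -[u in coprimez _ u]/(gre (GInt u v)) coprime_norm_re.
have cnu : coprimez (u + v) u by rewrite coprimez_sym -[u + v](_ : 1 * u + v = _) ?coprimezDMl //; ring.
have cnv : coprimez (u + v) v.
  by rewrite coprimez_sym -[u + v](_ : 1 * v + u = _) ?coprimezDMl 1?coprimez_sym //; ring.
have cNn : coprimez (gnorm (gprod ps)) (u + v).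
  rewrite psE coprimez_sym.
  have -> : gnorm (GInt u v) = (u - v) * (u + v) + 2 * v ^+ 2 by rewrite /gnorm /=; ring.
  by rewrite coprimezDMl coprimezMr coprimez_pexpr // cnv andbT coprimez_sym coprimez2.
have [lu hlu] := ratlist_exists (primaryz4 uo).
have Lu := qsyms_rational gps N8 hlu cNu; rewrite prn // in hlu.
have [ln hln] := ratlist_exists (primaryz4 no).
have Ln := qsyms_rational gps N8 hln cNn; rewrite prn // in hln.
have {}Lu : qsyms ps u%:~R = zsign ((u - 1) %/ 4)%Z.
  rewrite Lu -(ratlist_I u4 hlu) psE.
  transitivity (qsyms lu (v%:~R * gI)).
    apply: (ratlist_dvd hlu); rewrite -[v]/(gim (GInt u v)) gint_subr_im.
    by rewrite dvdg_refl // -gnorm_eq0 gnorm_int sqrf_eq0 odd_neq0.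
  by rewrite (qsymsM (rat_gprimes hlu)) (rat_int hlu) ?mul1r // coprimez_sym.
have {}Ln : qsyms ps (u + v)%:~R = qsyms ln (1 - gI).
  rewrite Ln psE; transitivity (qsyms ln (u%:~R * (1 - gI))).
    apply: (ratlist_dvd hln); have -> : GInt u v - u%:~R * (1 - gI) = (u + v)%:~R * gI.
      by apply: gint_eq; rewrite !gE /=; ring.
    have nz : (u + v)%:~R != 0 :> gint by rewrite -gnorm_eq0 gnorm_int sqrf_eq0 odd_neq0.
    by rewrite dvdgMr ?dvdg_refl.
  by rewrite (qsymsM (rat_gprimes hln)) (rat_int hln) ?mul1r // coprimez_sym.
have L1 : qsyms ps (u + v)%:~R = qsyms ps u%:~R * qsyms ps (1 + gI).
  rewrite -(qsymsM gps); apply: (qsyms_cong gps); rewrite psE.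
  have nz : GInt u v != 0 by rewrite -psE gprod_neq0.
  have -> : (u + v)%:~R - u%:~R * (1 + gI) = GInt u v * - gI.
    by apply: gint_eq; rewrite !gE /=; ring.
  by rewrite dvdgMr ?dvdg_refl.
have sq : qsyms ps (1 + gI) ^+ 2 = zsign ((u + v - 1) %/ 4)%Z.
  transitivity (qsyms ps (u + v)%:~R ^+ 2).
    by rewrite L1 Lu exprMn [X in _ = X * _]expr2 zsign_sq mul1r.
  rewrite Ln -(qsymsX (rat_gprimes hln)) -(ratlist_I n4 hln).
  rewrite (_ : (1 - gI) ^+ 2 = (-2)%:~R * gI) // (qsymsM (rat_gprimes hln)) (rat_int hln) ?mul1r //.
  by rewrite coprimez_sym coprimezN coprimez_sym coprimez2.
have/dvdzP[k uk] := u4; have/dvdzP[j vj] := v4.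
have LI : qsyms ps gI = zsign k.
  rewrite (@qsyms_I8 _ gps (k + 2 * k ^+ 2 + 2 * j ^+ 2)); last first.
    by rewrite psE /gnorm /= vj (_ : u = 4 * k + 1); [ring | move: uk; clear; lia].
  by apply: zsign_eq; apply/dvdzP; exists (k ^+ 2 + j ^+ 2); ring.
have -> : 2%:~R = (1 + gI) ^+ 2 * gI ^+ 3 :> gint by [].
rewrite (qsymsM gps) !(qsymsX gps) sq LI !exprS expr0 mulr1 -!zsignD; apply: zsign_eq.
by move: uk vj; clear; lia.
Qed.

(** Extraction of the content, with a sign that makes the quotient primary. *)
Lemma primary_content (u v : int) : (4 %| u - 1)%Z -> (4 %| v)%Z ->
  exists h u' v', [/\ (4 %| h - 1)%Z, u = u' * h, v = v' * h, (4 %| u' - 1)%Z &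
    (4 %| v')%Z /\ coprimez u' v'].
Proof.
move=> u4 v4; have uo : ~~ (2 %| u)%Z by move: u4; clear; lia.
have ho : ~~ (2 %| gcdz u v)%Z by apply: contra uo => /dvdz_trans; apply; apply: dvdz_gcdl.
have h4 := primaryz4 ho; set h := primaryz _ in h4.
have hE m : (h %| m)%Z = (gcdz u v %| m)%Z.
  by rewrite /h /primaryz; case: ifP => // _; rewrite !dvdzE abszN.
have/dvdzP[u' uE] : (h %| u)%Z by rewrite hE dvdz_gcdl.
have/dvdzP[v' vE] : (h %| v)%Z by rewrite hE dvdz_gcdr.
have/dvdzP[q hq] := h4; have hq' : h = 4 * q + 1 by move: hq; clear; lia.
exists h, u', v'; split=> //.
  have/dvdzP[k uk] := u4; apply/dvdzP; exists (k - u' * q).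
  by move: uk; rewrite uE hq'; clear; lia.
split.
  have/dvdzP[k vk] := v4; apply/dvdzP; exists (k - v' * q).
  by move: vk; rewrite vE hq'; clear; lia.
have h0 : h != 0 by rewrite hq'; clear; lia.
have [s [t st]] : exists s t, s * u + t * v = h.
  have [s [t st]] := Bezoutz u v; rewrite /h /primaryz; case: ifP => _; first by exists s, t.
  by exists (- s), (- t); rewrite -st; ring.
apply/coprimezP; exists (s, t) => /=; apply: (mulIf h0).
rewrite mul1r; transitivity (s * u + t * v); last by rewrite st.
by rewrite {1}uE {1}vE; ring.
Qed.

(** The content of [u + v i] is rational, so 2 has a trivial symbol modulo its factors. *)
Lemma factor_with_2 (u v : int) : (4 %| u - 1)%Z -> (4 %| v)%Z ->
  exists ps, [/\ gprimes ps, gprod ps = GInt u v & qsyms ps 2%:~R = zsign (v %/ 4)%Z].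
Proof.
move=> u4 v4; have [h [u' [v' [h4 uE vE u4' [v4' cop]]]]] := primary_content u4 v4.
have [ls hl] := ratlist_exists h4; have/dvdzP[q hq] := h4.
have hq' : h = 4 * q + 1 by move: hq; clear; lia.
have pw : primary (GInt u' v') by rewrite /primary /=; move: u4' v4'; clear; lia.
have [ps' gps' psE'] := primary_factor pw.
exists (ls ++ ps'); split.
- by apply/gprimes_cat; split=> //; apply: rat_gprimes hl.
- rewrite gprod_cat (rat_gprod hl) psE'; apply: gint_eq; rewrite !gE /= ?uE ?vE; ring.
rewrite qsyms_cat (rat_int hl) ?mul1r; last first.
  by apply: coprimez2; move: h4; clear; lia.
rewrite (qsyms_2 gps' psE') //; apply: zsign_eq.
have/dvdzP[j vj] := v4'; have {vE} -> : v = (j * h) * 4 by rewrite vE vj; ring.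
rewrite vj (mulzK j) // (mulzK (j * h)) // hq'.
by apply/dvdzP; exists (- 2 * j * q); ring.
Qed.

Lemma qsyms_pow2 ps (s : gint) k : gprimes ps -> qsyms ps 2%:~R = s -> qsyms ps (2 ^+ k)%:~R = s ^+ k.
Proof. by move=> gps <-; rewrite rmorphXn qsymsX. Qed.

Lemma zsignX a k : zsign a ^+ k = zsign (a * k%:Z).
Proof.
elim: k => [|k IH]; first by rewrite mulr0.
by rewrite exprS IH -zsignD; congr zsign; rewrite -addn1 PoszD; ring.
Qed.

Lemma two_adic (n : int) : n != 0 -> exists k m, ~~ (2 %| m)%Z /\ n = 2 ^+ k * m.
Proof.
have [b] := ubnP `|n|%N; elim: b n => // b IH n lt_n n0.
have [/dvdzP[m nE]|no] := boolP (2 %| n)%Z; last by exists 0%N, n; rewrite expr0 mul1r.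
have m0 : m != 0 by apply: contraNneq n0 => m0; rewrite nE m0 mul0r.
have [|k [m' [ho mE]]] := IH m _ m0; first by move: lt_n m0; rewrite nE; clear; lia.
by exists k.+1, m'; split=> //; rewrite nE mE exprS; ring.
Qed.


(** * The symbol of [a y + x i] modulo [c + d i] *)

Lemma coprimez_gprod ps (n : int) : (forall nu, nu \in ps -> coprimez n (gnorm nu)) ->
  coprimez n (gnorm (gprod ps)).
Proof.
elim: ps => [|nu ps IH] h; first by rewrite /gprod big_nil /gnorm /= expr0n addr0 expr1n coprimezE coprimen1.
rewrite /gprod big_cons gnormM coprimezMr h ?mem_head // IH // => mu hm.
by apply: h; rewrite inE hm orbT.
Qed.

Lemma gprime_coprime_int nu (n : int) : gprime nu ->
  coprimez n (gnorm nu) = ~~ dvdg nu n%:~R.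
Proof.
move=> gp; rewrite coprimez_sym; have [_ [sp|[l pr [l3 ->]]]] := gp; first exact: split_ncoprime.
rewrite gnorm_int sqrrN coprimez_pexpl // dvdg_natN ?prime_gt0 // !gE dvdz0 andbT.
by rewrite coprimezE dvdzE prime_coprime.
Qed.

Lemma coprimez_primes (m n : int) :
  (forall l, prime l -> (l%:Z %| m)%Z -> (l%:Z %| n)%Z -> False) -> coprimez m n.
Proof.
move=> h; rewrite coprimezE /coprime; apply/negPn/negP => g1.
have [l pr dv] : exists2 l, prime l & (l %| gcdn `|m| `|n|)%N.
  have [->|g0] := posnP (gcdn `|m| `|n|); first by exists 2.
  by exists (pdiv (gcdn `|m| `|n|)); [apply: pdiv_prime; move: g0 g1; clear; lia | apply: pdiv_dvd].
apply: (h _ pr); rewrite dvdzE; apply: dvdn_trans dv _; [exact: dvdn_gcdl | exact: dvdn_gcdr].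
Qed.

Lemma not_coprimez l (m n : int) : prime l -> (l%:Z %| m)%Z -> (l%:Z %| n)%Z -> ~~ coprimez m n.
Proof.
move=> pr hm hn; apply/negP => /coprimezP[[s t] /= st].
have := rpredD (dvdz_mull s hm) (dvdz_mull t hn).
by rewrite st prime_dvdz_gt1.
Qed.

Lemma coprimez_norm_prime (a : gint) l : prime l -> coprimez (gre a) (gim a) ->
  (l%:Z %| gnorm a)%Z -> (l%:Z %| gim a)%Z = false.
Proof.
move=> pr cop dN; apply/negP => dv; move: cop; apply/negP/(not_coprimez pr) => //.
apply: (@Euclid_dvdzX l _ 2 pr).
have -> : gre a ^+ 2 = gnorm a - gim a ^+ 2 by rewrite /gnorm; ring.
by rewrite rpredB // dvdz_exp.
Qed.

(** [gprod ks] is rational modulo every prime divisor of [n], so reciprocity leads to the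
symbol of a rational integer modulo another one. *)
Lemma qsyms_dvd_im ks (n : int) : gprimes ks -> (8 %| gnorm (gprod ks) - 1)%Z ->
  coprimez (gre (gprod ks)) (gim (gprod ks)) -> ~~ (2 %| n)%Z ->
  (forall l, prime l -> (l%:Z %| n)%Z -> (l%:Z %| gim (gprod ks))%Z) ->
  qsyms ks n%:~R = 1.
Proof.
move=> gks N8 cop no hn; have [ls hl] := ratlist_exists (primaryz4 no).
have gls := rat_gprimes hl.
rewrite (qsyms_rational gks N8 hl); last first.
  apply: coprimez_primes => l pr dN /(hn _ pr).
  by rewrite coprimez_norm_prime.
rewrite -(@rat_int _ _ hl (gre (gprod ks))); last first.
  rewrite coprimez_primaryz; apply: coprimez_primes => l pr dr /(hn _ pr) di.
  by have := not_coprimez pr dr di; rewrite cop.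
apply: (qsyms_cong_all gls) => nu hnu; have gp := gls _ hnu; have nz := gprime_nz gp.
have -> : gprod ks - (gre (gprod ks))%:~R = (gim (gprod ks))%:~R * gI.
  by rewrite {1}(gintE (gprod ks)) addrC addKr.
apply: dvdgMr => //; apply/negPn; rewrite -gprime_coprime_int //; apply/negP => c.
pose l := pdiv `|gnorm nu|%N.
have pr : prime l by apply: pdiv_prime; rewrite -ltz_nat absz_gnorm gprime_norm_gt1.
have dl : (l%:Z %| gnorm nu)%Z by rewrite dvdzE pdiv_dvd.
have dn : (l%:Z %| n)%Z.
  have := dvdz_trans dl (gnorm_gprod hnu); rewrite (rat_gprod hl) gnorm_int.
  move/(Euclid_dvdzX pr); rewrite /primaryz; case: ifP => // _.
  by rewrite !dvdzE abszN.
by have := not_coprimez pr (hn _ pr dn) dl; rewrite c.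
Qed.

Lemma gprod_filter (ps : seq gint) (P : pred gint) :
  gprod ps = gprod [seq nu <- ps | P nu] * gprod [seq nu <- ps | ~~ P nu].
Proof. by rewrite /gprod !big_filter (bigID P). Qed.

Lemma prime_ndvd_sqr (p : nat) (u v : int) : p%:Z = u ^+ 2 + v -> 0 < v -> u != 0 ->
  ~~ (p%:Z %| u)%Z.
Proof.
move=> pE v0 u0; apply/negP; rewrite dvdzE /= => /dvdn_leq; rewrite absz_gt0 => /(_ u0) pu.
by move: pu pE v0 u0; clear; nia.
Qed.

Section Key.
Variables (p : nat) (a c d x y : int).
Hypotheses (pr : prime p) (a_odd : ~~ (2 %| a)%Z).
Hypotheses (p_cd : p%:Z = c ^+ 2 + d ^+ 2) (p_xy : p%:Z = x ^+ 2 + (a ^+ 2 + 1) * y ^+ 2).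
Hypotheses (c4 : (4 %| c - 1)%Z) (x4 : (4 %| x - 1)%Z) (d4 : (4 %| d)%Z) (y4 : (4 %| y)%Z).
Hypotheses (d_gt0 : 0 < d) (y_gt0 : 0 < y).

Let pi := GInt c d.
Let rho := GInt x (- (a * y)).
Let M := gnorm rho.

Let pi_norm : gnorm pi = p%:Z.
Proof. by rewrite p_cd. Qed.

Let gp : gprime pi.
Proof.
split; first by rewrite /primary /=; move: c4 d4; clear; lia.
by left; rewrite /split_prime pi_norm.
Qed.

Let sp : split_prime pi.
Proof. by rewrite /split_prime pi_norm. Qed.

Let M_eq : M = p%:Z - y ^+ 2.
Proof. by rewrite /M /gnorm /= p_xy; ring. Qed.

Let p_ndvd_y : ~~ (p%:Z %| y)%Z.
Proof.
apply: (@prime_ndvd_sqr p y (x ^+ 2 + (a * y) ^+ 2)); [by rewrite p_xy; ring | | by rewrite gt_eqF].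
have x0 : x != 0 by apply: contraTneq x4 => ->.
by rewrite ltr_wpDr ?sqr_ge0 ?exprn_even_gt0.
Qed.

Let cop_pM : coprimez (gnorm pi) M.
Proof.
have hM : M = 1 * p%:Z + - y ^+ 2 by rewrite M_eq mul1r.
rewrite pi_norm hM coprimezDMl coprimezN.
by rewrite coprimez_pexpr // coprimezE prime_coprime // -dvdzE.
Qed.

(** The number [M'] is the quotient of the norm of [rho] by [g]; it is [- 2 y e] modulo
[kappa], and it is prime to the norm of [kappa]. *)
Lemma key_symbol : qsym pi (GInt (a * y) x) = qsym pi y%:~R * zsign ((d + y) %/ 4)%Z.
Proof.
have dy4 : (4 %| d + y)%Z by rewrite rpredD.
have [g [c' [e [g4 cE dyE c4' [e4 cop_ce]]]]] := primary_content c4 dy4.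
set kappa := GInt c' e; pose M' := g * gnorm kappa - 2 * y * e.
have dE : d = e * g - y by rewrite -dyE; ring.
have MM' : M = g * M'.
  rewrite M_eq p_cd cE dE /M' /gnorm /=; ring.
have g_odd : ~~ (2 %| g)%Z by move: g4; clear; lia.
have g0 : g != 0 := odd_neq0 g_odd.
have x_odd : ~~ (2 %| x)%Z by move: x4; clear; lia.
have c'_odd : ~~ (2 %| c')%Z by move: c4'; clear; lia.
have ay4 : (4 %| - (a * y))%Z by rewrite rpredN dvdz_mull.
have M0 : M != 0.
  by rewrite gnorm_eq0; apply: contraTneq x4 => -[-> _].
have M'0 : M' != 0 by apply: contraNneq M0 => h; rewrite MM' h mulr0.
have cop_cd : coprimez c d := split_coprime sp.
have cop_gy : coprimez g y.
  apply: coprimez_primes => l prl hg hy.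
  have hc : (l%:Z %| c)%Z by rewrite cE dvdz_mull.
  have hd : (l%:Z %| d)%Z by rewrite dE rpredB // dvdz_mull.
  by have := not_coprimez prl hc hd; rewrite cop_cd.
have N8k : (8 %| gnorm kappa - 1)%Z by rewrite one_mod8.
have N8r : (8 %| gnorm rho - 1)%Z by rewrite one_mod8.
have N8p : (8 %| gnorm pi - 1)%Z by rewrite one_mod8 //; move: c4; clear; lia.
have prime_ndvd_y l : prime l -> (l%:Z %| gnorm kappa)%Z -> (l%:Z %| y)%Z -> False.
  move=> prl hk hy.
  have h : (l%:Z %| p%:Z)%Z.
    have -> : p%:Z = g ^+ 2 * gnorm kappa - y * (y + 2 * d).
      by rewrite p_cd cE dE /gnorm /=; ring.
    exact: rpredB (dvdz_mull _ hk) (dvdz_mulr _ hy).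
  have lp : l = p by apply/eqP; rewrite -dvdn_prime2.
  by move: p_ndvd_y; rewrite -lp hy.
have not2 l : prime l -> (l%:Z %| gnorm kappa)%Z -> (l%:Z %| 2)%Z = false.
  move=> prl hk; apply/negP; rewrite dvdzE /= dvdn_prime2 // => /eqP lE.
  by move: hk N8k; rewrite lE; clear; lia.
have cop_kM' : coprimez (gnorm kappa) M'.
  apply: coprimez_primes => l prl hk hM.
  have : (l%:Z %| 2 * y * e)%Z.
    have -> : 2 * y * e = g * gnorm kappa - M' by rewrite /M'; ring.
    by rewrite rpredB // dvdz_mull.
  rewrite !Euclid_dvdzM // not2 // => /orP[hy|he]; first exact: (prime_ndvd_y l).
  by have := @coprimez_norm_prime kappa l prl cop_ce hk; rewrite he.
have [K [gK KE K2]] := factor_with_2 c4' e4.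
have [R [gR RE R2]] := factor_with_2 x4 ay4.
rewrite -/rho in RE; rewrite -/kappa in KE.
set R1 := [seq nu <- R | dvdg nu M'%:~R]; set R0 := [seq nu <- R | ~~ dvdg nu M'%:~R].
have inR1 nu : nu \in R1 -> [/\ gprime nu, dvdg nu M'%:~R & nu \in R].
  by rewrite mem_filter => /andP[h1 h2]; split=> //; apply: gR.
have cop_knu nu l : nu \in R1 -> prime l -> (l%:Z %| gnorm nu)%Z -> (l%:Z %| M')%Z.
  move=> /inR1[gn dn _] prl hl; apply: (@Euclid_dvdzX l _ 2 prl).
  by rewrite -gnorm_int; apply: dvdz_trans hl (dvdg_norm (gprime_nz gn) dn).
have cop_knu' nu : nu \in R1 -> coprimez (gnorm kappa) (gnorm nu).
  move=> hn; apply: coprimez_primes => l prl hk hl.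
  have hM := cop_knu nu l hn prl hl.
  by have := not_coprimez prl hk hM; rewrite cop_kM'.
(* Either nu divides M', and kappa y is congruent to i pi (conj kappa), or nu divides
   g, and i pi is congruent to y. *)
have step2 : qsyms R (gI * pi) = qsyms R y%:~R * qsyms (R1 ++ map gconj R1) kappa.
  rewrite qsyms_cat /qsyms big_map /R1 !big_filter -!big_split /= [X in _ = _ * X]big_mkcond -big_split /=.
  rewrite !big_seq; apply: eq_bigr => nu hnu; have gn := gR _ hnu; have nz := gprime_nz gn.
  case: ifP => dM; last first.
    rewrite mulr1; apply: (qsym_cong gn).
    have -> : gI * pi - y%:~R = g%:~R * (gI * kappa).
      by apply: gint_eq; rewrite /pi /kappa !gE /= ?cE ?dE; ring.
    apply: dvdgMr => //.
    have : dvdg nu (g * M')%:~R.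
      rewrite -MM' /M gnormE; apply: dvdgMr => //; rewrite -RE.
      by apply: (dvdg_gprod gR hnu); rewrite dvdg_refl // gprod_neq0.
    by rewrite rmorphM gprime_EuclidE // dM orbF.
  have hR1 : nu \in R1 by rewrite mem_filter dM.
  have nk : ~~ dvdg nu (gconj kappa).
    by apply: gprime_conorm => //; rewrite gnorm_conj coprimez_sym cop_knu'.
  have h : qsym nu (kappa * y%:~R) = qsym nu (gI * pi * gconj kappa).
    apply: (qsym_cong gn).
    have -> : kappa * y%:~R - gI * pi * gconj kappa = M'%:~R * - gI.
      by apply: gint_eq; rewrite /pi /kappa /M' /gnorm !gE /= ?cE ?dE; ring.
    exact: dvdgMr.
  move: h; rewrite !(qsymM gn) => h.
  have -> : qsym (gconj nu) kappa = gconj (qsym nu (gconj kappa)) by rewrite -qsym_conj // gconjK.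
  rewrite mulrA [qsym nu y%:~R * _]mulrC h -!mulrA qunits_mulC ?mulr1 //.
  exact: qsym_unit.
set M1 := gnorm (gprod R1); set M2 := gnorm (gprod R0).
have M12 : M1 * M2 = M by rewrite -gnormM /M -RE -gprod_filter.
have gR1 : gprimes R1 by move=> nu /inR1[].
have gL1 : gprimes (R1 ++ map gconj R1).
  by apply/gprimes_cat; split=> //; apply: gprimes_conj.
have L1E : gprod (R1 ++ map gconj R1) = M1%:~R by rewrite gprod_cat gprod_conj gnormE.
have cop_kM1 : coprimez (gnorm kappa) M1 by apply: coprimez_gprod.
have step3 : qsyms (R1 ++ map gconj R1) kappa = qsyms K M1%:~R.
  rewrite -KE -L1E; symmetry; apply: quartic_reciprocity => //.
    by rewrite L1E KE gnorm_int coprimez_pexpr.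
  by rewrite L1E gim_int.
(* N(rho) = g M' = M1 M2 with M' and M2 coprime: M' divides M1. *)
have cop_M'2 : coprimez M' M2.
  apply: coprimez_gprod => nu; rewrite mem_filter => /andP[dn hn].
  by rewrite gprime_coprime_int //; apply: gR.
have/dvdzP[g2 M1E] : (M' %| M1)%Z by rewrite -(Gauss_dvdzl M1 cop_M'2) M12 MM' dvdz_mull.
have gE2 : g = g2 * M2 by apply: (mulIf M'0); rewrite -MM' -M12 M1E; ring.
have Kgcd : coprimez (gre (gprod K)) (gim (gprod K)) by rewrite KE.
have N8K : (8 %| gnorm (gprod K) - 1)%Z by rewrite KE.
have N8R : (8 %| gnorm (gprod R) - 1)%Z by rewrite RE.
(* A prime l dividing g2 divides g and M', hence 2 y e; as g is odd and prime to y, l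
   divides e. *)
have Kg2 : qsyms K g2%:~R = 1.
  apply: qsyms_dvd_im => //; first by apply: contra g_odd; rewrite gE2; apply: dvdz_mulr.
  move=> l prl hl; rewrite KE /=.
  have hM' : (l%:Z %| M')%Z.
    apply/negPn/negP => nd.
    have : coprimez l%:Z M1.
      apply: coprimez_gprod => nu hnu; apply: coprimez_primes => q prq.
      rewrite dvdzE /= dvdn_prime2 // => /eqP -> /(cop_knu _ _ hnu prl).
      by rewrite (negPf nd).
    by apply/negP/(not_coprimez prl); rewrite ?dvdzz // M1E dvdz_mulr.
  have hg : (l%:Z %| g)%Z by rewrite gE2 dvdz_mulr.
  have : (l%:Z %| 2 * y * e)%Z.
    have -> : 2 * y * e = g * gnorm kappa - M' by rewrite /M'; ring.
    exact: rpredB (dvdz_mulr _ hg) hM'.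
  rewrite !Euclid_dvdzM // => /orP[/orP[h2|hy]|//].
    have/eqP lE : l == 2 by rewrite -dvdn_prime2 //; move: h2; rewrite dvdzE.
    by move: hg g_odd; rewrite lE => ->.
  by have := not_coprimez prl hg hy; rewrite cop_gy.
have step5 : qsyms K M'%:~R = qsyms K (2 * y * e)%:~R.
  have knz : kappa != 0 by rewrite -KE gprod_neq0.
  rewrite -[RHS](qsyms_opp gK N8K); apply: (qsyms_cong gK); rewrite KE.
  have -> : M'%:~R - - (2 * y * e)%:~R = kappa * (gconj kappa * g%:~R).
    rewrite mulrA -gnormE -rmorphM opprK -rmorphD; congr _%:~R; rewrite /M'; ring.
  by rewrite dvdgMr ?dvdg_refl.
have e0 : e != 0.
  by apply: contraTneq d_gt0 => h; move: dyE; rewrite h mul0r; move: y_gt0; clear; lia.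
have y0 : y != 0 by move: y_gt0; clear; lia.
have [k [y1 [y1o yE]]] := two_adic y0; have [m [e1 [e1o eE]]] := two_adic e0.
have y1y : (y1 %| y)%Z by rewrite yE dvdz_mull.
have Ke1 : qsyms K e1%:~R = 1.
  by apply: qsyms_dvd_im => // l _ hl; rewrite KE /= eE dvdz_mull.
have [Y hY] := ratlist_exists (primaryz4 y1o); have gY := rat_gprimes hY.
have y1_nz : y1 != 0 := odd_neq0 y1o.
have dvdY (u v : gint) (s : int) : u - v = s%:~R * gI -> (y1 %| s)%Z -> qsyms Y u = qsyms Y v.
  move=> uv hs; apply: (ratlist_dvd hY); rewrite dvdg_primaryz // uv.
  by apply: dvdgMr; rewrite ?dvdg_intint // -gnorm_eq0 gnorm_int sqrf_eq0.
have py1 : coprimez (gnorm pi) y1.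
  rewrite pi_norm coprimezE prime_coprime //; apply: contra p_ndvd_y => h.
  by apply: dvdz_trans y1y; rewrite dvdzE.
have Ry1 : qsyms R y1%:~R = 1.
  have cx : coprimez x y1.
    apply: coprimez_primes => l prl hx hy; have hy' := dvdz_trans hy y1y.
    have : (l%:Z %| p%:Z)%Z by rewrite p_xy rpredD // ?dvdz_exp // dvdz_mull // dvdz_exp.
    rewrite dvdzE /= dvdn_prime2 // => /eqP lp; move: p_ndvd_y; rewrite -lp.
    by rewrite hy'.
  rewrite (qsyms_rational gR N8R hY); last first.
    rewrite RE; apply: coprimez_primes => l prl hM hy; have hy' := dvdz_trans hy y1y.
    have : (l%:Z %| x)%Z.
      apply: (@Euclid_dvdzX l _ 2 prl); have -> : x ^+ 2 = gnorm rho - (a * y) ^+ 2.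
        by rewrite /gnorm /=; ring.
      by rewrite rpredB // dvdz_exp // dvdz_mull.
    by move=> hx; have := not_coprimez prl hx hy; rewrite cx.
  rewrite -(@rat_int _ _ hY x) ?coprimez_primaryz // RE.
  apply: (dvdY _ _ (- (a * y))); last by rewrite rpredN dvdz_mull.
  by apply: gint_eq; rewrite /rho !gE /=; ring.
have Ky1 : qsyms K y1%:~R = qsym pi y1%:~R.
  rewrite (qsyms_rational gK N8K hY); last first.
    rewrite KE; apply: coprimez_primes => l prl hk hy.
    by apply: (prime_ndvd_y l) => //; apply: dvdz_trans y1y.
  rewrite -[RHS]qsyms_seq1 (qsyms_rational (gprimes1 gp) _ hY); rewrite /gprod big_seq1 //.
  rewrite -/(gprod K) KE; transitivity (qsyms Y (g%:~R * kappa)).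
    rewrite (qsymsM gY) (rat_int hY) ?mul1r // coprimez_primaryz.
    by apply: coprimez_dvdr cop_gy; rewrite -dvdzE.
  by apply: (dvdY _ _ y) => //; apply: gint_eq; rewrite /pi /kappa !gE /= ?cE ?dE; ring.
have [D dD] : exists D, d = D * 4 by apply/dvdzP.
have [Y' yY] : exists Y', y = Y' * 4 by apply/dvdzP.
have [E eE4] : exists E, e = E * 4 by apply/dvdzP.
have pi2 : qsym pi 2%:~R = zsign D.
  have piL : gprod [:: pi] = pi by rewrite /gprod big_seq1.
  by rewrite -qsyms_seq1 (qsyms_2 (gprimes1 gp) piL c4 d4 cop_cd) dD mulzK.
have K2' : qsyms K 2%:~R = zsign E by rewrite K2 eE4 mulzK.
have R2' : qsyms R 2%:~R = zsign Y'.
  rewrite R2 yY mulrA -mulNr mulzK //; apply: zsign_eq.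
  have [s ->] : exists s, a = 2 * s + 1 by exists (a %/ 2)%Z; move: a_odd; clear; lia.
  by apply/dvdzP; exists (- (s + 1) * Y'); ring.
have M'E : qsyms K M'%:~R = zsign (E * (k + m).+1%:Z) * qsym pi y1%:~R.
  have -> : zsign (E * (k + m).+1%:Z) * qsym pi y1%:~R = qsyms K (2 ^+ (k + m).+1)%:~R * (qsyms K y1%:~R * qsyms K e1%:~R).
    by rewrite (qsyms_pow2 _ gK K2') zsignX Ky1 Ke1 mulr1.
  rewrite step5 -!(qsymsM gK) -!rmorphM; congr (qsyms K _%:~R).
  by rewrite {1}yE {1}eE exprS exprD; ring.
have RyE : qsyms R y%:~R = zsign (Y' * k%:Z).
  by rewrite {1}yE rmorphM (qsymsM gR) Ry1 mulr1 (qsyms_pow2 _ gR R2') zsignX.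
have piyE : qsym pi y%:~R = zsign (D * k%:Z) * qsym pi y1%:~R.
  rewrite {1}yE rmorphM qsymM // -qsyms_seq1.
  by rewrite (@qsyms_pow2 _ (zsign D) k (gprimes1 gp)) ?zsignX // qsyms_seq1.
have recR : qsym pi rho = qsyms R pi.
  rewrite -RE; apply: qsym_qsyms_reciprocity => //; first by rewrite RE.
  by rewrite RE.
have/dvdzP[q hq] := N8p.
have step1 : qsym pi (GInt (a * y) x) = qsyms R (gI * pi).
  have -> : GInt (a * y) x = gI * rho by apply: gint_eq; rewrite /rho !gE /=; ring.
  rewrite (qsymM gp) (qsymsM gR) recR; congr (_ * _).
  rewrite -qsyms_seq1 (@qsyms_I8 _ (gprimes1 gp) q); last first.
    by rewrite /gprod big_seq1; move: hq; clear; lia.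
  rewrite (@qsyms_I8 _ gR (q - 2 * Y' ^+ 2)); last first.
    rewrite RE -/M M_eq -pi_norm yY; move: hq; move: (gnorm pi) => N; clear => h.
    by have -> : N = q * 8 + 1 by [move: h; clear; lia]; ring.
  by apply: zsign_eq; apply/dvdzP; exists (Y' ^+ 2); ring.
rewrite step1 step2 step3 M1E rmorphM (qsymsM gK) Kg2 mul1r M'E RyE piyE.
rewrite mulrA -zsignD mulrAC -zsignD; congr (_ * _); apply: zsign_eq.
have dyE4 : ((d + y) %/ 4)%Z = D + Y' by rewrite dD yY -mulrDl mulzK.
rewrite dyE4.
have Eg : E * g = D + Y' by apply: (@mulIf _ 4) => //; rewrite mulrDl -dD -yY dyE eE4; ring.
have [s gs] : exists s, g = 2 * s + 1 by exists (g %/ 2)%Z; move: g_odd; clear; lia.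
(* The exponent m of 2 in e is 2 when e / 4 is odd. *)
have evm : (2 %| E * m%:Z)%Z.
  move: eE e1o; rewrite eE4; clear; case: m => [|[|[|m]]].
  - by rewrite expr0 mul1r; lia.
  - by rewrite expr1; lia.
  - by move=> _ _; apply: dvdz_mull.
  by move=> h _; apply: dvdz_mulr; move: h; rewrite !exprS; lia.
have -> : D = E * g - Y' by rewrite Eg addrK.
have/dvdzP[t tE] := evm.
have -> : Y' * k%:Z + E * (k + m).+1%:Z - ((E * g - Y') * k%:Z + (E * g - Y' + Y'))
  = 2 * Y' * k%:Z + E * (1 - g) * (k%:Z + 1) + E * m%:Z.
  by rewrite -addn1 !PoszD; ring.
by rewrite tE gs; apply/dvdzP; exists (Y' * k%:Z - E * s * (k%:Z + 1) + t); ring.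
Qed.
End Key.

(** * Powers of [a + sqrt (a ^ 2 + 1)] *)

(** The coefficients do not depend on the ring nor on the chosen square root. *)
Lemma quadratic_pow (a b : int) n : exists U V : int,
  forall (R : comNzRingType) (s : R), s ^+ 2 = b%:~R ->
    (a%:~R + s) ^+ n = U%:~R + V%:~R * s.
Proof.
elim: n => [|n [U [V IH]]]; first by exists 1, 0 => R s _; rewrite expr0 mul0r addr0.
exists (a * U + V * b), (a * V + U) => R s s2.
rewrite exprS (IH R s s2) !rmorphD !rmorphM /= -s2; ring.
Qed.

Definition isign (m : int) : int := if (2 %| m)%Z then 1 else -1.

Lemma isign_gint m : (isign m)%:~R = zsign m :> gint.
Proof. by rewrite /isign /zsign; case: ifP. Qed.

Lemma exprN1z (m : int) : (-1) ^ m = (isign m)%:~R :> algC.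
Proof.
have h (n : nat) : (-1) ^+ n = (isign n)%:~R :> algC.
  rewrite -signr_odd /isign; have -> : (2 %| n%:Z)%Z = ~~ odd n by rewrite dvdzE dvdn2.
  by case: (odd n).
case: m => n; first exact: h.
by rewrite NegzE -exprz_inv invrN1 -[_ ^ _]/(_ ^+ n.+1) h /isign !dvdzE abszN.
Qed.

Section Lift.
Variables (p : nat) (a c d x y : int).
Hypotheses (pr : prime p) (a_odd : ~~ (2 %| a)%Z).
Hypotheses (p_cd : p%:Z = c ^+ 2 + d ^+ 2) (p_xy : p%:Z = x ^+ 2 + (a ^+ 2 + 1) * y ^+ 2).
Hypotheses (c4 : (4 %| c - 1)%Z) (x4 : (4 %| x - 1)%Z) (d4 : (4 %| d)%Z) (y4 : (4 %| y)%Z).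
Hypotheses (d_gt0 : 0 < d) (y_gt0 : 0 < y).

Let n := (p.-1 %/ 4)%N.
Let eps := isign ((d + y) %/ 4)%Z.

(** Both square roots of [a ^ 2 + 1] modulo [p] give the same sign, since
[(a + S) (a - S) = -1]. *)
Lemma sqrt_mod : exists S : int,
  [/\ (p%:Z %| S ^+ 2 - (a ^+ 2 + 1))%Z, (p%:Z %| (a + S) ^+ n - eps)%Z &
      (p%:Z %| (a - S) ^+ n - eps)%Z].
Proof.
have pN : gnorm (GInt c d) = p%:Z by rewrite p_cd.
have sp : split_prime (GInt c d) by rewrite /split_prime pN.
have gp : gprime (GInt c d).
  split; last by left.
  by rewrite /primary /=; move: c4 d4; clear; lia.
have key := key_symbol pr a_odd p_cd p_xy c4 x4 d4 y4 d_gt0 y_gt0.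
set pi := GInt c d in pN sp gp key *; have nz := gprime_nz gp.
have x0 : x != 0 by apply: contraTneq x4 => ->.
have ndy : ~~ (p%:Z %| y)%Z.
  apply: (@prime_ndvd_sqr p y (x ^+ 2 + (a * y) ^+ 2)); [by rewrite p_xy; ring | | by rewrite gt_eqF].
  by rewrite ltr_wpDr ?sqr_ge0 ?exprn_even_gt0.
have pdvd (m : int) : dvdg pi m%:~R = (p%:Z %| m)%Z by rewrite split_dvdg_int // pN.
have [r hr] := split_residue gI gp sp.
have [[t w] /= tw] : exists tw : int * int, tw.1 * y + tw.2 * p%:Z = 1.
  by apply/coprimezP; rewrite coprimez_sym coprimezE prime_coprime.
(* i is r modulo pi and t is the inverse of y: S represents x i / y. *)
pose S := x * r%:Z * t.
have hS : dvdg pi ((y * S)%:~R - x%:~R * gI).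
  have -> : (y * S)%:~R - x%:~R * gI
      = x%:~R * (- (gI - r%:R)) + (- (x * r%:Z * w) * p%:Z)%:~R.
    have -> : y * S = x * r%:Z * (1 - w * p%:Z) by rewrite -tw /S; ring.
    by rewrite -[r%:R]/(r%:Z%:~R) !rmorphM !rmorphB !rmorphM !rmorphN !rmorphM /= rmorph1; ring.
  apply: (dvdgD nz); first by rewrite dvdgMl // dvdgN.
  by rewrite pdvd dvdz_mull.
have S2 : (p%:Z %| S ^+ 2 - (a ^+ 2 + 1))%Z.
  have : dvdg pi ((y * S)%:~R ^+ 2 - (x%:~R * gI) ^+ 2) by apply: dvdg_modX.
  rewrite [(x%:~R * gI) ^+ 2]exprMn (_ : gI ^+ 2 = -1) // mulrN1 opprK -!rmorphXn -rmorphD pdvd.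
  have -> : (y * S) ^+ 2 + x ^+ 2 = y * (y * (S ^+ 2 - (a ^+ 2 + 1))) + p%:Z.
    by rewrite p_xy; ring.
  by rewrite rpredDr ?dvdzz // !Euclid_dvdzM // (negPf ndy).
have ndyg : ~~ dvdg pi y%:~R by rewrite pdvd.
have uy := qsym_unit gp ndyg.
have qsymS : qsym pi (a + S)%:~R = zsign ((d + y) %/ 4)%Z.
  have h : qsym pi (GInt (a * y) x) = qsym pi y%:~R * qsym pi (a + S)%:~R.
    rewrite -qsymM //; apply: (qsym_cong gp); rewrite dvdg_sym //.
    have -> : y%:~R * (a + S)%:~R - GInt (a * y) x = (y * S)%:~R - x%:~R * gI.
      by apply: gint_eq; rewrite !gE /=; ring.
    exact: hS.
  move: h; rewrite key => /(congr1 (fun z => gconj (qsym pi y%:~R) * z)).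
  by rewrite !mulrA [gconj _ * _]mulrC qunits_mulC // !mul1r.
have qE : qexp pi = n by rewrite /qexp pN.
have qsymSm : qsym pi (a - S)%:~R = zsign ((d + y) %/ 4)%Z.
  have : qsym pi ((a + S) * (a - S))%:~R = qsym pi (-1).
    apply: (qsym_cong gp); rewrite opprK -[1]/(1%:~R) -rmorphD pdvd.
    have -> : (a + S) * (a - S) + 1 = - (S ^+ 2 - (a ^+ 2 + 1)) by ring.
    by rewrite rpredN.
  rewrite rmorphM qsymM // qsymS qsym_N1 // (@zsign_even (gim pi %/ 2)%Z); last first.
    by move: d4; rewrite /=; clear; lia.
  by move/(congr1 (fun z => zsign ((d + y) %/ 4)%Z * z)); rewrite mulrA zsign_sq mul1r mulr1.
exists S; split=> //.
  by rewrite -pdvd rmorphB rmorphXn /= /eps isign_gint -qsymS -qE qsym_spec.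
by rewrite -pdvd rmorphB rmorphXn /= /eps isign_gint -qsymSm -qE qsym_spec.
Qed.

(** The values [U + V S] and [U - V S] are both congruent to the sign, and [S] is invertible
modulo [p]. *)
Lemma quadratic_pow_mod : exists U V : int,
  [/\ forall s : algC, s ^+ 2 = (a ^+ 2 + 1)%:~R -> (a%:~R + s) ^+ n = U%:~R + V%:~R * s,
      (p%:Z %| U - eps)%Z & (p%:Z %| V)%Z].
Proof.
have [S [S2 Sp Sm]] := sqrt_mod; have [U [V UV]] := quadratic_pow a (a ^+ 2 + 1) n.
have ch := pchar_Fp pr.
have toFp (m m' : int) : (p%:Z %| m - m')%Z -> m%:~R = m'%:~R :> 'F_p.
  by rewrite (dvdz_pcharf ch) rmorphB subr_eq0 => /eqP.
have fromFp (m m' : int) : m%:~R = m'%:~R :> 'F_p -> (p%:Z %| m - m')%Z.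
  by move=> h; rewrite (dvdz_pcharf ch) rmorphB /= h subrr.
have s2 : (S%:~R : 'F_p) ^+ 2 = (a ^+ 2 + 1)%:~R by rewrite -rmorphXn; apply: toFp.
have s2' : (- S%:~R : 'F_p) ^+ 2 = (a ^+ 2 + 1)%:~R by rewrite sqrrN.
have e1 : (U + V * S)%:~R = eps%:~R :> 'F_p.
  rewrite rmorphD rmorphM /= -(UV _ _ s2) -rmorphD -rmorphXn; exact: toFp.
have e2 : (U - V * S)%:~R = eps%:~R :> 'F_p.
  by rewrite rmorphB rmorphM /= -mulrN -(UV _ _ s2') -rmorphB -rmorphXn; apply: toFp.
have p2 : (p%:Z %| 2)%Z = false.
  apply/negP; rewrite dvdzE /= dvdn_prime2 // => /eqP p2.
  move: p_cd c4 d4; rewrite p2; clear => h /dvdzP[u hu] /dvdzP[v hv]; move: h.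
  have -> : c = 4 * u + 1 by lia.
  rewrite hv; lia.
have x0 : x != 0 by apply: contraTneq x4 => ->.
have ndx : ~~ (p%:Z %| x)%Z.
  apply: prime_ndvd_sqr p_xy _ x0; rewrite mulr_gt0 ?exprn_even_gt0 //=; last by rewrite gt_eqF.
  by rewrite ltr_wpDl ?sqr_ge0.
have ndS : ~~ (p%:Z %| S)%Z.
  apply/negP => hS; move/negP: ndx; apply; apply: (@Euclid_dvdzX p x 2 pr).
  have -> : x ^+ 2 = p%:Z + y ^+ 2 * ((S ^+ 2 - (a ^+ 2 + 1)) - S * S) by rewrite p_xy; ring.
  by apply: rpredD; rewrite ?dvdzz // dvdz_mull // rpredB // dvdz_mulr.
exists U, V; split=> [s hs||]; first exact: UV.
  have := rpredD (fromFp _ _ e1) (fromFp _ _ e2).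
  have -> : U + V * S - eps + (U - V * S - eps) = 2 * (U - eps) by ring.
  by rewrite Euclid_dvdzM // p2.
have := rpredB (fromFp _ _ e1) (fromFp _ _ e2).
have -> : U + V * S - eps - (U - V * S - eps) = 2 * (V * S) by ring.
by rewrite !Euclid_dvdzM // p2 (negPf ndS) orbF.
Qed.
End Lift.

Lemma prime_not_square (p : nat) (z : int) : prime p -> p%:Z <> z ^+ 2.
Proof.
move=> pr /(congr1 absz); rewrite abszX /= -mulnn; move: `|z|%N => m pE.
have/primeP[p1 /(_ m)] := pr; rewrite pE dvdn_mulr // => /(_ isT).
by case/orP => /eqP mE; move: p1; rewrite pE; move: mE; clear; nia.
Qed.

(* The divisions by 4 below are all exact: 4 divides p - 1 and y, and the
   hypotheses force 4 to divide d. *)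
Theorem corollary5p1 (p k r : nat) (a c d d0 x y : int)
  (p_prime : prime p) (p_eq : p = (8 * k + 1)%N)
  (a_odd : ~~ (2 %| a)%Z)
  (p_cd : p%:Z = c ^+ 2 + d ^+ 2)
  (p_xy : p%:Z = x ^+ 2 + (a ^+ 2 + 1) * y ^+ 2)
  (c_mod4 : (c = 1 %[mod 4])%Z)
  (d_eq : d = 2 ^+ r * d0)
  (d0_mod4 : (d0 = 1 %[mod 4])%Z)
  (y_mod4 : (4 %| y)%Z)
  (coprime_or : gcdz c (x + d) = 1 \/ gcdz d0 (x + c) = 1) :
  Zsqrt_eqmod (a ^+ 2 + 1) p%:Z
    ((a%:~R + sqrtC (a ^+ 2 + 1)%:~R) ^+ ((p - 1) %/ 4)%N)
    ((-1) ^ ((d %/ 4)%Z + (y %/ 4)%Z)).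
Proof.
have c4 : (4 %| c - 1)%Z by rewrite -eqz_mod_dvd; apply/eqP.
have d4 : (4 %| d)%Z.
  have/dvdzP[u hu] := c4; have cE : c = 4 * u + 1 by move: hu; clear; lia.
  move: p_cd; rewrite p_eq cE; clear; nia.
have d_neq0 : d != 0 by apply/eqP => d0E; apply: (prime_not_square p_prime (z := c)); rewrite p_cd d0E expr0n addr0.
have y_neq0 : y != 0 by apply/eqP => y0E; apply: (prime_not_square p_prime (z := x)); rewrite p_xy y0E expr0n mulr0 addr0.
have x_odd : ~~ (2 %| x)%Z.
  have/dvdzP[v hv] := y_mod4; apply/negP => /dvdzP[u hu].
  by move: p_xy; rewrite p_eq hu hv; clear; lia.
have p_cd' : p%:Z = c ^+ 2 + `|d| ^+ 2 by rewrite real_normK ?num_real.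
have p_xy' : p%:Z = (primaryz x) ^+ 2 + (a ^+ 2 + 1) * `|y| ^+ 2.
  by rewrite real_normK ?num_real // /primaryz; case: ifP; rewrite ?sqrrN.
have d4' : (4 %| `|d|)%Z by move: d4; clear; lia.
have y4' : (4 %| `|y|)%Z by move: y_mod4; clear; lia.
have d_gt0 : 0 < `|d| by rewrite normr_gt0.
have y_gt0 : 0 < `|y| by rewrite normr_gt0.
have [U [V [UV /dvdzP[U' pU] /dvdzP[V' pV]]]] :=
  quadratic_pow_mod p_prime a_odd p_cd' p_xy' c4 (primaryz4 x_odd) d4' y4' d_gt0 y_gt0.
have epsE : isign ((`|d| + `|y|) %/ 4)%Z = isign ((d %/ 4)%Z + (y %/ 4)%Z).
  rewrite /isign; congr (if _ then _ else _).
  by move: d4 y_mod4; clear; lia.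
rewrite epsE in pU; rewrite subn1 (UV _ (sqrtCK _)) exprN1z.
set e := isign _ in pU *; split.
- by exists U, V.
- by exists e, 0; rewrite mul0r addr0.
exists (U'%:~R + V'%:~R * sqrtC (a ^+ 2 + 1)%:~R); first by exists U', V'.
have -> : U = U' * p%:Z + e by rewrite -pU subrK.
by rewrite pV !rmorphD !rmorphM /=; ring.
Qed.
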